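(* Let $T\colon[0,1]\to[0,1]$ be continuous and topologically mixing. There exist dense Mycielski sets $M_1,M_2,M_3\subset[0,1]$ and numbers $\delta_n>0$ ($n\ge2$) such that: (1) for $i=1,2$ and every $n\ge2$, each $n$-tuple of pairwise distinct points of $M_i$ is $\delta_n$-Li-Yorke; (2) every point of $M_1$ has dense orbit in $[0,1]$; (3) there is a minimal Cantor set $A$ such that $\omega(x,T)=A$ for every $x\in M_2$, and $M_2\cap A$ contains a Cantor set; (4) $M_3\times M_3$ contains no Li-Yorke pairs.
   Context: $T$ is topologically mixing if for all nonempty open $U,V$, $T^n(U)\cap V\ne\emptyset$ for all sufficiently large $n$. A Mycielski set is a countable union of Cantor sets. With $\rho(x,y)=|x-y|$, a tuple is $\delta$-Li-Yorke if $\liminf_n\max_{i,j}\rho(T^nx_i,T^nx_j)=0$ and $\limsup_n\min_{i\ne j}\rho(T^nx_i,T^nx_j)>\delta$; a pair is Li-Yorke if it is $\delta$-Li-Yorke for some $\delta>0$. A minimal set is a nonempty closed invariant set with no proper nonempty closed invariant subset; $\omega(x,T)$ is the $\omega$-limit set. *)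

(* Defs.v *)
From Stdlib Require Import Reals.
Open Scope R_scope.

Definition I01 (x : R) : Prop := 0 <= x <= 1.

Fixpoint iter (n : nat) (T : R -> R) (x : R) : R :=
  match n with O => x | S k => T (iter k T x) end.

(* T is a continuous self-map of [0,1] (its values off [0,1] are irrelevant). *)
Definition self_map01 (T : R -> R) : Prop := forall x, I01 x -> I01 (T x).
Definition continuous01 (T : R -> R) : Prop :=
  forall x, I01 x -> forall eps, eps > 0 ->
    exists d, d > 0 /\ forall y, I01 y -> Rabs (y - x) < d -> Rabs (T y - T x) < eps.

Definition open01 (U : R -> Prop) : Prop :=
  (forall x, U x -> I01 x) /\
  forall x, U x -> exists e, e > 0 /\ forall y, I01 y -> Rabs (y - x) < e -> U y.

Definition top_mixing (T : R -> R) : Prop :=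
  forall U V : R -> Prop, open01 U -> open01 V ->
    (exists u, U u) -> (exists v, V v) ->
    exists N : nat, forall n : nat, (n >= N)%nat ->
      exists x, U x /\ V (iter n T x).

Definition closed_set (A : R -> Prop) : Prop :=
  forall x, (forall eps, eps > 0 -> exists y, A y /\ Rabs (x - y) < eps) -> A x.

Definition dense01 (M : R -> Prop) : Prop :=
  (forall x, M x -> I01 x) /\
  forall x, I01 x -> forall eps, eps > 0 -> exists y, M y /\ Rabs (x - y) < eps.

Definition cantor_continuous (f : (nat -> bool) -> R) : Prop :=
  forall a eps, eps > 0 -> exists N : nat, forall b,
    (forall k, (k < N)%nat -> b k = a k) -> Rabs (f b - f a) < eps.

(* A Cantor set: a subset of R homeomorphic to the Cantor space 2^N
   (a continuous injection of the compact space 2^N is a homeomorphism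
   onto its image). *)
Definition cantor_set (C : R -> Prop) : Prop :=
  exists f : (nat -> bool) -> R,
    cantor_continuous f /\
    (forall a b, f a = f b -> a = b) /\
    (forall y, C y <-> exists a, f a = y).

Definition mycielski (M : R -> Prop) : Prop :=
  exists C : nat -> (R -> Prop), (forall k, cantor_set (C k)) /\
    (forall y, M y <-> exists k, C k y).

(* delta-Li-Yorke n-tuple (x 0, ..., x (n-1)), with rho(x,y)=|x-y|:
   liminf_k max_{i,j} rho(T^k x_i, T^k x_j) = 0   and
   limsup_k min_{i<>j} rho(T^k x_i, T^k x_j) > delta.
   Unfolded: liminf of a nonnegative sequence is 0 iff it is < eps infinitely
   often for each eps > 0; limsup > delta iff it exceeds some eta > delta
   infinitely often. *)
Definition li_yorke_tuple (T : R -> R) (delta : R) (n : nat) (x : nat -> R) : Prop :=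
  (forall eps, eps > 0 -> forall N : nat, exists k : nat, (k >= N)%nat /\
     forall i j, (i < n)%nat -> (j < n)%nat ->
       Rabs (iter k T (x i) - iter k T (x j)) < eps) /\
  (exists eta, eta > delta /\ forall N : nat, exists k : nat, (k >= N)%nat /\
     forall i j, (i < n)%nat -> (j < n)%nat -> i <> j ->
       Rabs (iter k T (x i) - iter k T (x j)) > eta).

Definition pair_tuple (x y : R) : nat -> R := fun i => match i with O => x | _ => y end.

Definition li_yorke_pair (T : R -> R) (x y : R) : Prop :=
  exists delta, delta > 0 /\ li_yorke_tuple T delta 2 (pair_tuple x y).

Definition dense_orbit (T : R -> R) (x : R) : Prop :=
  forall y, I01 y -> forall eps, eps > 0 -> exists k : nat, Rabs (iter k T x - y) < eps.

Definition omega_limit (T : R -> R) (x : R) (y : R) : Prop :=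
  forall eps, eps > 0 -> forall N : nat, exists k : nat, (k >= N)%nat /\
    Rabs (iter k T x - y) < eps.

Definition closed_invariant (T : R -> R) (A : R -> Prop) : Prop :=
  (forall x, A x -> I01 x) /\ closed_set A /\ (forall x, A x -> A (T x)).

Definition minimal_set (T : R -> R) (A : R -> Prop) : Prop :=
  closed_invariant T A /\ (exists a, A a) /\
  forall B : R -> Prop, closed_invariant T B -> (exists b, B b) ->
    (forall x, B x -> A x) -> forall x, A x -> B x.

(* Main.v *)
(** The idea throughout is to code orbits by points of the Cantor space.

    Mixing and the intermediate value theorem give: for [u < v] and [al, be]
    inside the open interval, [T^n [u, v]] contains [al, be] for all large [n].
    Hence some power [T^N] has a horseshoe, and since a wandering interval
    would contradict mixing, the horseshoe codes the full one-sided 2-shift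
    homeomorphically.

    For [M3], a sequence [a] is written along the ruler sequence (the 2-adic
    valuation of time); different sequences then differ syndetically, so their
    orbits stay apart.  For [M2], a point [a] is sent to the sequence whose
    block of length [2^(k+1)] is the block of [a] followed by the block of
    [psi_k a], both of length [2^k], where [psi_k] runs through locally
    constant maps of the Cantor space.  Constant [psi_k] give proximality and uniform
    recurrence (hence minimality of the orbit closure), and separating [psi_k]
    give windows of bounded length in which any given [n] points differ.  For
    [M1], orbits are prescribed to visit a basis of intervals at suitable times.

    In each case one Cantor set is spread over [0,1] by pulling it back along
    powers of [T]: a pulled back point eventually has the orbit of the point it
    came from.  The continuous selections needed come from a lower
    semicontinuous one, which is continuous on a Cantor subset. *)

From Stdlib Require Import Reals Lra Lia List FinFun Arith Cantor.
From Stdlib Require Import Classical ClassicalEpsilon FunctionalExtensionality.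
From mathcomp Require Import choice.
Require Import Defs.
Open Scope R_scope.

(** * Cantor space *)

Definition agree {X : Type} (n : nat) (a b : nat -> X) : Prop :=
  forall k, (k < n)%nat -> b k = a k.

Definition shift {X : Type} (a : nat -> X) : nat -> X := fun k => a (S k).

Definition distinct {X : Type} (n : nat) (a : nat -> X) : Prop :=
  forall i j, (i < n)%nat -> (j < n)%nat -> i <> j -> a i <> a j.

Lemma agree_refl {X : Type} n (a : nat -> X) : agree n a a.
Proof. intros k _; reflexivity. Qed.

Lemma agree_trans {X : Type} n (a b c : nat -> X) :
  agree n a b -> agree n b c -> agree n a c.
Proof. intros H1 H2 k Hk; rewrite H2, H1; auto. Qed.

Lemma agree_le {X : Type} m n (a b : nat -> X) :
  (m <= n)%nat -> agree n a b -> agree m a b.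
Proof. intros Hmn H k Hk; apply H; lia. Qed.

Lemma agree_shift {X : Type} n (a b : nat -> X) :
  agree (S n) a b -> agree n (shift a) (shift b).
Proof. intros H k Hk; unfold shift; apply H; lia. Qed.

Lemma min_nat (P : nat -> Prop) :
  (exists n, P n) -> exists n, P n /\ forall k, (k < n)%nat -> ~ P k.
Proof.
  intros [n Hn]; revert Hn.
  induction n as [n IH] using lt_wf_ind; intros Hn.
  destruct (classic (exists k, (k < n)%nat /\ P k)) as [[k [Hk Pk]]|H].
  - apply (IH k Hk Pk).
  - exists n; split; auto. intros k Hk Pk; apply H; eauto.
Qed.

Lemma first_difference {X : Type} (a b : nat -> X) :
  a <> b -> exists k, agree k a b /\ a k <> b k.
Proof.
  intros Hab.
  destruct (min_nat (fun k => a k <> b k)) as [k [Hk Hmin]].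
  - apply NNPP; intros H; apply Hab; extensionality k.
    apply NNPP; intros Hk; apply H; eauto.
  - exists k; split; auto. intros i Hi.
    symmetry; apply NNPP; intros H; exact (Hmin i Hi H).
Qed.

Lemma bound_below (P : nat -> nat -> Prop) n :
  (forall i L L', (L <= L')%nat -> P i L -> P i L') ->
  (forall i, (i < n)%nat -> exists L, P i L) ->
  exists L, forall i, (i < n)%nat -> P i L.
Proof.
  intros Hmono; induction n as [|n IH]; intros H.
  - exists O; intros i Hi; lia.
  - destruct IH as [L HL]; [intros i Hi; apply H; lia|].
    destruct (H n) as [L' HL']; [lia|].
    exists (L + L')%nat; intros i Hi.
    destruct (Nat.eq_dec i n) as [->|Hne].
    + apply Hmono with L'; auto; lia.
    + apply Hmono with L; [lia|apply HL; lia].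
Qed.

Lemma bound_below_R (P : nat -> R -> Prop) n :
  (forall i d d', 0 < d' <= d -> P i d -> P i d') ->
  (forall i, (i < n)%nat -> exists d, d > 0 /\ P i d) ->
  exists d, d > 0 /\ forall i, (i < n)%nat -> P i d.
Proof.
  intros Hmono; induction n as [|n IH]; intros H.
  - exists 1; split; [lra|]; intros i Hi; lia.
  - destruct IH as [d [Hd HL]]; [intros i Hi; apply H; lia|].
    destruct (H n) as [d' [Hd' HL']]; [lia|].
    assert (Hm : 0 < Rmin d d') by (apply Rmin_glb_lt; lra).
    pose proof (Rmin_l d d'); pose proof (Rmin_r d d').
    exists (Rmin d d'); split; [lra|]; intros i Hi.
    destruct (Nat.eq_dec i n) as [->|Hne].
    + apply Hmono with d'; auto.
    + apply Hmono with d; [lra|apply HL; lia].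
Qed.

Lemma choice_any {A X : Type} (P : A -> X -> Prop) :
  (forall n, exists x, P n x) -> exists f, forall n, P n (f n).
Proof.
  intros H.
  exists (fun n => proj1_sig (constructive_indefinite_description _ (H n))).
  intros n; apply proj2_sig.
Qed.

(** * Cantor schemes and continuous selections *)

Fixpoint branch {X : Type} (next : nat -> X -> bool -> X) (x0 : X) (k : nat)
    (s : nat -> bool) : X :=
  match k with
  | O => x0
  | S k' => next k' (branch next x0 k' s) (s k')
  end.

Lemma branch_agree {X : Type} next (x0 : X) k s s' :
  agree k s s' -> branch next x0 k s' = branch next x0 k s.
Proof.
  induction k as [|k IH]; simpl; intros H; auto.
  rewrite IH, H; auto. apply agree_le with (S k); auto.
Qed.

Definition lsc (f : (nat -> bool) -> R) : Prop :=
  forall a eps, eps > 0 -> exists n, forall b, agree n a b -> f b > f a - eps.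

Lemma Rabs_le_bounds x e : Rabs x <= e -> - e <= x <= e.
Proof.
  intros H; pose proof (Rle_abs x); pose proof (Rle_abs (- x)).
  rewrite Rabs_Ropp in *; lra.
Qed.

Lemma archimed_inv eps : eps > 0 -> exists n : nat, / INR (S n) < eps.
Proof.
  intros H. destruct (archimed_cor1 eps H) as [N [HN HN0]].
  exists (pred N). replace (S (pred N)) with N by lia. exact HN.
Qed.

(* Near a point where [f] almost attains its supremum over a cylinder, lower
   semicontinuity bounds [f] from below as well. *)
Lemma lsc_small_oscillation f a n eps :
  (forall b, 0 <= f b <= 1) -> lsc f -> eps > 0 ->
  exists c, (n <= snd c)%nat /\ agree n a (fst c) /\
    forall b, agree (snd c) (fst c) b -> Rabs (f b - f (fst c)) <= eps.
Proof.
  intros Hf Hl He.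
  destruct (completeness (fun v => exists b, agree n a b /\ f b = v)) as [m [Hub Hlub]].
  - exists 1; intros v [b [_ <-]]; apply Hf.
  - exists (f a), a; split; auto using agree_refl.
  - destruct (classic (exists b, agree n a b /\ f b > m - eps / 2)) as [[b [Hb Hfb]]|H].
    + destruct (Hl b (eps / 2)) as [k Hk]; [lra|].
      exists (b, n + k)%nat; simpl; split; [lia|split; auto].
      intros b' Hb'.
      assert (f b' > f b - eps / 2) by (apply Hk; apply agree_le with (n + k)%nat; auto; lia).
      assert (f b' <= m).
      { apply Hub; exists b'; split; auto. apply agree_trans with b; auto.
        apply agree_le with (n + k)%nat; auto; lia. }
      assert (f b <= m) by (apply Hub; exists b; auto).
      apply Rabs_le; lra.
    + assert (m <= m - eps / 2); [|lra].
      apply Hlub; intros v [b [Hb <-]].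
      apply Rnot_lt_le; intros Hc; apply H; exists b; split; auto; lra.
Qed.

(** A binary tree of cylinders is grown: a node is split by the value of its first free bit, and
    each half is shrunk until [f] oscillates little on it. The map [g] sends a branch to the point
    of its nested cylinders, so [f] is continuous along [g] although it need not be continuous
    itself. *)
Lemma lsc_continuous_reparametrization f :
  (forall b, 0 <= f b <= 1) -> lsc f ->
  exists g : (nat -> bool) -> (nat -> bool),
    (forall s s', g s = g s' -> s = s') /\ cantor_continuous (fun s => f (g s)).
Proof.
  intros Hf Hl.
  (* A pair [c] stands for the cylinder of the first [snd c] bits of [fst c]; position [snd c] is
     the first free one, so the two values of [b] give disjoint halves. *)
  pose (set_bit := fun (c : (nat -> bool) * nat) (b : bool) (i : nat) =>
    if Nat.eq_dec i (snd c) then b else fst c i).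
  destruct (choice_any (fun (p : nat * ((nat -> bool) * nat) * bool) c =>
    let '(k, c0, b) := p in
    (S (snd c0) <= snd c)%nat /\ agree (S (snd c0)) (set_bit c0 b) (fst c) /\
    forall b', agree (snd c) (fst c) b' -> Rabs (f b' - f (fst c)) <= / INR (S k)))
    as [next Hnext].
  { intros [[k c0] b]. apply (lsc_small_oscillation f (set_bit c0 b)); auto.
    apply Rinv_0_lt_compat, lt_0_INR; lia. }
  pose (nx := fun k c b => next (k, c, b)).
  pose (nd := branch nx ((fun _ => false), O)).
  assert (Hnx : forall k s,
    (S (snd (nd k s)) <= snd (nd (S k) s))%nat /\
    agree (S (snd (nd k s))) (set_bit (nd k s) (s k)) (fst (nd (S k) s)) /\
    forall b', agree (snd (nd (S k) s)) (fst (nd (S k) s)) b' ->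
      Rabs (f b' - f (fst (nd (S k) s))) <= / INR (S k)).
  { intros k s. exact (Hnext (k, nd k s, s k)). }
  clearbody nx.
  assert (Hlen : forall k s, (k <= snd (nd k s))%nat).
  { induction k; intros s; [lia|]. destruct (Hnx k s) as [H _]. specialize (IHk s). lia. }
  assert (Hstep : forall k s, agree (snd (nd k s)) (fst (nd k s)) (fst (nd (S k) s))).
  { intros k s i Hi. destruct (Hnx k s) as [_ [H _]]. rewrite H by lia.
    unfold set_bit. destruct (Nat.eq_dec i (snd (nd k s))); [lia|auto]. }
  assert (Hle : forall k j s, (k <= j)%nat ->
    (snd (nd k s) <= snd (nd j s))%nat /\ agree (snd (nd k s)) (fst (nd k s)) (fst (nd j s))).
  { intros k j s H; induction H as [|j H IH].
    - split; auto using agree_refl.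
    - destruct IH as [IH1 IH2]. destruct (Hnx j s) as [H1 _]. split; [lia|].
      apply agree_trans with (fst (nd j s)); auto.
      apply agree_le with (snd (nd j s)); auto. }
  (* The node at depth [S i] has already fixed bit [i], since lengths grow by at least one per
     level. *)
  pose (g := fun s i => fst (nd (S i) s) i).
  assert (Hg : forall k s, agree (snd (nd k s)) (fst (nd k s)) (g s)).
  { intros k s i Hi; unfold g. destruct (le_lt_dec k (S i)) as [H|H].
    - apply (Hle k (S i) s H); auto.
    - symmetry. apply (Hle (S i) k s); [lia|]. specialize (Hlen (S i) s); lia. }
  exists g; split.
  - intros s s' Hgs. apply NNPP; intros Hne.
    destruct (first_difference s s' Hne) as [k [Hk Hd]].
    assert (Hnd : nd k s' = nd k s) by (apply branch_agree; auto).
    assert (Hat : forall u, g u (snd (nd k u)) = u k).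
    { intros u. destruct (Hnx k u) as [H1 [H2 _]].
      rewrite (Hg (S k) u) by lia. rewrite H2 by lia.
      unfold set_bit. destruct (Nat.eq_dec (snd (nd k u)) (snd (nd k u))); congruence. }
    apply Hd. rewrite <- (Hat s), <- (Hat s'), Hgs, Hnd. reflexivity.
  - intros s eps He.
    destruct (archimed_inv (eps / 2)) as [k Hk]; [lra|].
    exists (S k); intros b Hb.
    assert (Hnd : nd (S k) b = nd (S k) s) by (apply branch_agree; auto).
    destruct (Hnx k s) as [_ [_ Ho]].
    pose proof (Ho _ (Hg (S k) s)) as H1.
    assert (H2 : Rabs (f (g b) - f (fst (nd (S k) s))) <= / INR (S k)).
    { apply Ho. rewrite <- Hnd. apply Hg. }
    apply Rabs_def1; apply Rabs_le_bounds in H1; apply Rabs_le_bounds in H2; lra.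
Qed.

(* [min (E s)] is a lower semicontinuous function of [s] when the graph of
   [E] is closed, so it is continuous along a suitable Cantor scheme. *)
Lemma closed_graph_selection (E : (nat -> bool) -> R -> Prop) :
  (forall s, exists x, E s x) -> (forall s x, E s x -> 0 <= x <= 1) ->
  (forall s x, ~ E s x -> exists n e, e > 0 /\
     forall s' x', agree n s s' -> Rabs (x' - x) < e -> ~ E s' x') ->
  exists (g : (nat -> bool) -> (nat -> bool)) (h : (nat -> bool) -> R),
    (forall s s', g s = g s' -> s = s') /\ cantor_continuous h /\
    forall s, E (g s) (h s).
Proof.
  intros Hne H01 Hcl.
  assert (Hmin : forall s, exists m, E s m /\ forall x, E s x -> m <= x).
  { intros s. destruct (completeness (fun v => E s (- v))) as [m [Hub Hlub]].
    - exists 0; intros v Hv. apply H01 in Hv; lra.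
    - destruct (Hne s) as [x Hx]; exists (- x). rewrite Ropp_involutive; auto.
    - exists (- m); split.
      + apply NNPP; intros Hn. destruct (Hcl s (- m) Hn) as [n [e [He H]]].
        assert (m <= m - e); [|lra].
        apply Hlub; intros v Hv. apply Rnot_lt_le; intros Hc.
        assert (v <= m) by (apply Hub; auto).
        apply (H s (- v)); auto using agree_refl. apply Rabs_def1; lra.
      + intros x Hx. assert (- x <= m); [|lra].
        apply Hub; rewrite Ropp_involutive; auto. }
  destruct (choice_any _ Hmin) as [f Hf].
  destruct (lsc_continuous_reparametrization f) as [g [Hg Hc]].
  - intros b; apply (H01 b), Hf.
  - intros a eps He.
    (* A tube argument: [Q z] says that near [a] no fibre of [E] has a point up to level [z]. The
       supremum of such levels is shown to be [f a - eps] and to be attained, which bounds the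
       minimum [f b] from below near [a]. *)
    pose (Q := fun z => 0 <= z <= f a - eps /\ exists n, forall b x, agree n a b ->
      x <= z -> ~ E b x).
    destruct (Rle_or_lt 0 (f a - eps)) as [H0|H0].
    2:{ exists O; intros b _. destruct (Hf b) as [Hb _]. apply H01 in Hb; lra. }
    assert (HnE : forall x, x <= f a - eps -> ~ E a x).
    { intros x Hx HE. apply (Hf a) in HE; lra. }
    assert (HQ0 : Q 0).
    { destruct (Hcl a 0) as [n [e [Hep H]]]; [apply HnE; auto|].
      split; [lra|]. exists n; intros b x Hb Hx HE.
      pose proof (H01 _ _ HE). apply (H b x); auto. apply Rabs_def1; lra. }
    destruct (completeness Q) as [m [Hub Hlub]].
    + exists (f a - eps); intros z Hz; apply Hz.
    + exists 0; auto.
    + assert (Hm1 : m <= f a - eps) by (apply Hlub; intros z Hz; apply Hz).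
      assert (Hm0 : 0 <= m) by (apply Hub; auto).
      destruct (Hcl a m) as [n [e [Hep H]]]; [apply HnE; auto|].
      assert (HQz : exists z, Q z /\ z > m - e).
      { apply NNPP; intros Hno. assert (m <= m - e); [|lra].
        apply Hlub; intros z Hz. apply Rnot_lt_le; intros Hc; apply Hno; eauto. }
      destruct HQz as [z [[Hz [n' Hn']] Hze]].
      assert (Hz' : forall w b x, w < m + e -> agree (n + n') a b -> x <= w -> ~ E b x).
      { intros w b x Hw Hb Hx. destruct (Rle_or_lt x z) as [Hxz|Hxz].
        - apply Hn'; auto. apply agree_le with (n + n')%nat; auto; lia.
        - apply H; [apply agree_le with (n + n')%nat; auto; lia|].
          apply Rabs_def1; lra. }
      assert (Hmeq : m = f a - eps).
      { apply Rle_antisym; auto. apply Rnot_lt_le; intros Hlt.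
        pose proof (Rmin_l (m + e / 2) (f a - eps)).
        pose proof (Rmin_r (m + e / 2) (f a - eps)).
        assert (Hw : m < Rmin (m + e / 2) (f a - eps)) by (apply Rmin_glb_lt; lra).
        assert (HQw : Q (Rmin (m + e / 2) (f a - eps))).
        { split; [lra|]. exists (n + n')%nat; intros b x Hb Hx.
          apply (Hz' (Rmin (m + e / 2) (f a - eps))); auto; lra. }
        apply Hub in HQw; lra. }
      exists (n + n')%nat; intros b Hb. apply Rnot_le_lt; intros Hle.
      apply (Hz' m b (f b)); auto; try lra. apply Hf.
  - exists g, (fun s => f (g s)); split; [auto|split; auto].
    intros s; apply Hf.
Qed.

(** * Symbolic sequences *)

Lemma locally_constant_agree {X : Type} (F : (nat -> bool) -> nat -> X) :
  (forall t, exists L, forall a b, agree L a b -> F a t = F b t) ->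
  forall n, exists L, forall a b, agree L a b -> agree n (F a) (F b).
Proof.
  intros H n.
  destruct (bound_below (fun t L => forall a b, agree L a b -> F a t = F b t) n)
    as [L HL].
  - intros t L L' HLL HP a b Hab; apply HP; apply agree_le with L'; auto.
  - intros t _; apply H.
  - exists L; intros a b Hab t Ht. symmetry; apply HL; auto.
Qed.

Lemma distinct_separated {X : Type} n (a : nat -> nat -> X) :
  distinct n a ->
  exists l, forall i j, (i < n)%nat -> (j < n)%nat -> i <> j ->
    exists r, (r < l)%nat /\ a i r <> a j r.
Proof.
  intros Ha.
  destruct (bound_below (fun i l => forall j, (j < n)%nat -> i <> j ->
    exists r, (r < l)%nat /\ a i r <> a j r) n) as [l Hl].
  - intros i L L' HL H j Hj Hij. destruct (H j Hj Hij) as [r [Hr Hd]].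
    exists r; split; auto; lia.
  - intros i Hi.
    destruct (bound_below (fun j l => i <> j ->
      exists r, (r < l)%nat /\ a i r <> a j r) n) as [l Hl].
    + intros j L L' HL H Hij. destruct (H Hij) as [r [Hr Hd]].
      exists r; split; auto; lia.
    + intros j Hj. destruct (Nat.eq_dec i j) as [->|Hij].
      * exists O; congruence.
      * destruct (first_difference (a i) (a j)) as [k [_ Hk]]; [apply Ha; auto|].
        exists (S k); intros _; exists k; auto.
    + exists l; auto.
  - exists l; intros i j Hi Hj Hij; apply Hl; auto.
Qed.

(** * Enumerating locally constant maps and a dense sequence of the Cantor space *)

Definition prefix (n : nat) (a : nat -> bool) : list bool := map a (seq 0 n).

Lemma prefix_agree n a b : prefix n a = prefix n b <-> agree n a b.
Proof.
  unfold prefix; split.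
  - intros H k Hk.
    assert (He : forall c : nat -> bool, c k = nth k (map c (seq 0 n)) (c O)).
    { intros c. rewrite map_nth, seq_nth; auto. }
    rewrite (He a), (He b), <- H. apply nth_indep. rewrite length_map, length_seq; auto.
  - intros H. apply map_ext_in; intros k Hk. apply in_seq in Hk.
    symmetry; apply H; lia.
Qed.

(** A decision table: a locally constant map to [nat] becomes finite data, so that all tables can be
    enumerated. The first matching word decides, and 0 is the default value. *)
Fixpoint lookup (l : list (list bool * nat)) (a : nat -> bool) : nat :=
  match l with
  | nil => O
  | (w, v) :: l' =>
      if list_eq_dec Bool.bool_dec (prefix (length w) a) w then v else lookup l' a
  end.

Definition unpickle_or {X : choice.Countable.type} (d : choice.Countable.sort X) (m : nat) :
    choice.Countable.sort X :=
  match choice.unpickle m with Some x => x | None => d end.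

Lemma pickle_inj (X : choice.Countable.type) (x y : choice.Countable.sort X) :
  choice.pickle x = choice.pickle y -> x = y.
Proof.
  intros H.
  assert (Some x = Some y) by (rewrite <- (choice.pickleK x), H; apply choice.pickleK).
  congruence.
Qed.

Lemma injective_unbounded (f : nat -> nat) :
  (forall r r', f r = f r' -> r = r') -> forall M, exists r, (M <= f r)%nat.
Proof.
  intros Hf M. apply NNPP; intros H.
  assert (Hlt : forall r, (f r < M)%nat).
  { intros r; apply not_le; intros Hc; apply H; exists r; lia. }
  assert (Hn : NoDup (map f (seq 0 (S M)))).
  { apply Injective_map_NoDup; [exact Hf|apply seq_NoDup]. }
  apply NoDup_incl_length with (l' := seq 0 M) in Hn.
  - rewrite length_map, !length_seq in Hn; lia.
  - intros z Hz. apply in_map_iff in Hz. destruct Hz as [r [<- _]].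
    apply in_seq; specialize (Hlt r); lia.
Qed.

Definition code_table (m : nat) : list (list bool * nat) :=
  fst (unpickle_or ((nil : list (list bool * nat)), O) m).

Definition code (m : nat) (a : nat -> bool) : nat := lookup (code_table m) a.

(** Finite words padded with [false], enumerated by their pickling codes. *)
Definition dense_seq (v : nat) : nat -> bool :=
  fun k => nth k (unpickle_or (nil : list bool) v) false.

(* The second component of the pickled pair is a dummy, present only so that
   every table occurs at arbitrarily large indices. *)
Lemma code_table_often l M : exists m, (M <= m)%nat /\ code_table m = l.
Proof.
  destruct (injective_unbounded (fun r => choice.pickle (l, r))) with (M := M) as [r Hr].
  - intros r r' H. apply pickle_inj in H. congruence.
  - exists (choice.pickle (l, r)); split; auto.
    unfold code_table, unpickle_or. rewrite choice.pickleK; reflexivity.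
Qed.

Lemma code_locally_constant m :
  exists L, forall a b, agree L a b -> code m a = code m b.
Proof.
  unfold code. induction (code_table m) as [|[w v] l [L IH]].
  - exists O; auto.
  - exists (length w + L)%nat; intros a b H; simpl.
    replace (prefix (length w) b) with (prefix (length w) a).
    2:{ apply prefix_agree; apply agree_le with (length w + L)%nat; auto; lia. }
    rewrite (IH a b); auto. apply agree_le with (length w + L)%nat; auto; lia.
Qed.

Lemma code_bounded m : exists B, forall a, (code m a <= B)%nat.
Proof.
  unfold code. induction (code_table m) as [|[w v] l [B IH]].
  - exists O; auto.
  - exists (v + B)%nat; intros a; simpl.
    destruct (list_eq_dec _ _ _); [lia|]. specialize (IH a); lia.
Qed.

Lemma code_constant v M : exists m, (M <= m)%nat /\ forall a, code m a = v.
Proof.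
  destruct (code_table_often ((nil, v) :: nil) M) as [m [Hm Hl]].
  exists m; split; auto. intros a; unfold code; rewrite Hl; reflexivity.
Qed.

(** Prefixes of a common length [l] tell the [n] points apart, so the table that lists these
    prefixes with the prescribed values has exactly one match at each point. *)
Lemma code_assign n (a : nat -> nat -> bool) (v : nat -> nat) M :
  distinct n a ->
  exists m, (M <= m)%nat /\ forall i, (i < n)%nat -> code m (a i) = v i.
Proof.
  intros Ha. destruct (distinct_separated n a Ha) as [l Hl].
  destruct (code_table_often (map (fun i => (prefix l (a i), v i)) (seq 0 n)) M)
    as [m [Hm Ht]].
  exists m; split; auto. intros i Hi; unfold code; rewrite Ht.
  assert (Hgen : forall k s, (s <= i < s + k)%nat -> (s + k <= n)%nat ->
    lookup (map (fun i => (prefix l (a i), v i)) (seq s k)) (a i) = v i).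
  { induction k as [|k IH]; intros s H1 H2; [lia|]. simpl.
    destruct (list_eq_dec _ _ _) as [E|E].
    - replace (length (prefix l (a s))) with l in E
        by (unfold prefix; rewrite length_map, length_seq; auto).
      destruct (Nat.eq_dec s i) as [->|Hne]; auto.
      apply prefix_agree in E. destruct (Hl i s) as [r [Hr Hd]]; auto; try lia.
      exfalso; apply Hd; symmetry; apply E; auto.
    - destruct (Nat.eq_dec s i) as [->|Hne]; [|apply IH; lia].
      exfalso; apply E. unfold prefix at 2; rewrite length_map, length_seq; auto. }
  apply Hgen; lia.
Qed.

Lemma dense_seq_agree a n : exists v, agree n a (dense_seq v).
Proof.
  exists (choice.pickle (prefix n a)). intros k Hk.
  unfold dense_seq, unpickle_or. rewrite choice.pickleK; simpl.
  unfold prefix. rewrite nth_indep with (d' := a O) by (rewrite length_map, length_seq; auto).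
  rewrite map_nth, seq_nth; auto.
Qed.

Lemma dense_seq_distinct : exists v : nat -> nat, forall i j, i <> j ->
  dense_seq (v i) <> dense_seq (v j).
Proof.
  (* [Nat.eqb i] is the indicator sequence of [i]; its first [S i] bits already separate it from the
     later ones. *)
  destruct (choice_any (fun i v => agree (S i) (Nat.eqb i) (dense_seq v))) as [v Hv].
  { intros i; apply dense_seq_agree. }
  exists v.
  assert (Hlt : forall i j, (i < j)%nat -> dense_seq (v i) <> dense_seq (v j)).
  { intros i j Hij He.
    assert (H1 : dense_seq (v i) i = Nat.eqb i i) by (apply Hv; lia).
    assert (H2 : dense_seq (v j) i = Nat.eqb j i) by (apply Hv; lia).
    rewrite He, H2, Nat.eqb_refl in H1. apply Nat.eqb_eq in H1; lia. }
  intros i j Hij. destruct (Nat.lt_ge_cases i j) as [H|H].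
  - apply Hlt; auto.
  - intros E; symmetry in E; revert E. apply Hlt; lia.
Qed.

(** * Hierarchical sequences *)

Fixpoint block (k : nat) (a : nat -> bool) (t : nat) : bool :=
  match k with
  | O => a O
  | S k' => if Nat.ltb t (2 ^ k') then block k' a t
            else block k' (dense_seq (code k' a)) (t - 2 ^ k')
  end.

(** Here psi_k is [fun a => dense_seq (code k a)]. Level [t] is high enough to read time [t] because
    [t < 2 ^ t], and higher blocks extend lower ones. *)
Definition hierarchical (a : nat -> bool) (t : nat) : bool := block t a t.

Lemma block_hierarchical k a t : (t < 2 ^ k)%nat -> block k a t = hierarchical a t.
Proof.
  assert (H : forall k' d, (t < 2 ^ k')%nat -> block (d + k') a t = block k' a t).
  { induction d as [|d IH]; intros Ht; auto. simpl.
    assert (Hlt : (t < 2 ^ (d + k'))%nat).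
    { apply Nat.lt_le_trans with (2 ^ k')%nat; auto. apply Nat.pow_le_mono_r; lia. }
    apply Nat.ltb_lt in Hlt; rewrite Hlt; auto. }
  intros Ht. unfold hierarchical.
  rewrite <- (H k t Ht), Nat.add_comm. apply H, Nat.pow_gt_lin_r; lia.
Qed.

Lemma hierarchical_0 a : hierarchical a 0 = a O.
Proof. reflexivity. Qed.

(** With [hierarchical_0] this recursion determines the sequence, since a positive time is its
    leading power of two plus a smaller remainder. *)
Lemma hierarchical_pow k a t : (t < 2 ^ k)%nat ->
  hierarchical a (2 ^ k + t) = hierarchical (dense_seq (code k a)) t.
Proof.
  intros Ht. rewrite <- (block_hierarchical (S k)) by (simpl; lia). simpl.
  assert (H : Nat.ltb (2 ^ k + t) (2 ^ k) = false) by (apply Nat.ltb_ge; lia).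
  rewrite H. replace (2 ^ k + t - 2 ^ k)%nat with t by lia.
  apply block_hierarchical; auto.
Qed.

Lemma leading_power t : (t > 0)%nat -> exists k r, t = (2 ^ k + r)%nat /\ (r < 2 ^ k)%nat.
Proof.
  intros Ht. destruct (Nat.log2_spec t Ht) as [H1 H2].
  exists (Nat.log2 t), (t - 2 ^ Nat.log2 t)%nat. simpl in H2; lia.
Qed.

Lemma hierarchical_locally_constant t :
  exists L, forall a b, agree L a b -> hierarchical a t = hierarchical b t.
Proof.
  induction t as [t IH] using lt_wf_ind.
  destruct t as [|t].
  - exists 1%nat; intros a b H. rewrite !hierarchical_0. symmetry; apply H; lia.
  - destruct (leading_power (S t)) as [k [r [-> Hr]]]; [lia|].
    destruct (code_locally_constant k) as [L HL].
    exists L; intros a b H. rewrite !hierarchical_pow by auto. rewrite (HL a b); auto.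
Qed.

(** At some level [m] the code sends [a] and [b] to sequences with different first symbols, and
    these symbols are read at time [2 ^ m]. *)
Lemma hierarchical_inj a b : hierarchical a = hierarchical b -> a = b.
Proof.
  intros H. apply NNPP; intros Hne.
  destruct (dense_seq_agree (fun _ => false) 1) as [v0 H0].
  destruct (dense_seq_agree (fun _ => true) 1) as [v1 H1].
  destruct (code_assign 2 (fun i => match i with O => a | _ => b end)
     (fun i => match i with O => v0 | _ => v1 end) O) as [m [_ Hm]].
  { intros [|[|i]] [|[|j]] Hi Hj Hij; try lia; auto. }
  pose proof (Nat.pow_nonzero 2 m) as Hp.
  assert (Ha : hierarchical a (2 ^ m + 0) = false).
  { rewrite hierarchical_pow, hierarchical_0 by lia. rewrite (Hm O) by lia. apply H0; lia. }
  assert (Hb : hierarchical b (2 ^ m + 0) = true).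
  { rewrite hierarchical_pow, hierarchical_0 by lia. rewrite (Hm 1%nat) by lia. apply H1; lia. }
  congruence.
Qed.

(** At a level with constant code the second half of the block is the same for every [a]. *)
Lemma hierarchical_proximal M : exists t, (M <= t)%nat /\ forall a i, (i < M)%nat ->
  hierarchical a (t + i) = hierarchical (dense_seq O) i.
Proof.
  destruct (code_constant O M) as [m [Hm Hc]].
  assert (m < 2 ^ m)%nat by (apply Nat.pow_gt_lin_r; lia).
  exists (2 ^ m)%nat; split; [lia|]. intros a i Hi.
  rewrite hierarchical_pow, Hc by lia; auto.
Qed.

(** The window length [l] depends on [n] only: [n] reference sequences are fixed in advance, and at
    suitable levels the code carries any [n] distinct points to them. This uniformity is what makes
    the Li-Yorke constant independent of the tuple. *)
Lemma hierarchical_separated n : exists l, forall a, distinct n a -> forall M,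
  exists t, (M <= t)%nat /\ forall i j, (i < n)%nat -> (j < n)%nat -> i <> j ->
    exists r, (r < l)%nat /\ hierarchical (a i) (t + r) <> hierarchical (a j) (t + r).
Proof.
  destruct dense_seq_distinct as [v Hv].
  destruct (distinct_separated n (fun i => hierarchical (dense_seq (v i)))) as [l Hl].
  { intros i j _ _ Hij H. apply hierarchical_inj in H. apply (Hv i j); auto. }
  exists l; intros a Ha M.
  destruct (code_assign n a v (M + l) Ha) as [m [Hm Hc]].
  assert (m < 2 ^ m)%nat by (apply Nat.pow_gt_lin_r; lia).
  exists (2 ^ m)%nat; split; [lia|]. intros i j Hi Hj Hij.
  destruct (Hl i j Hi Hj Hij) as [r [Hr Hd]].
  exists r; split; auto. rewrite !hierarchical_pow by lia. rewrite !Hc; auto.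
Qed.

(** If the code of level [m] is constant, every aligned block of length [2 ^ S m] ends with the same
    half. Removing the leading power of two from the block number [r] reduces to [r = 0], at the
    price of replacing [a]. *)
Lemma hierarchical_at_multiple m v (Hc : forall a, code m a = v) r a i :
  (i < 2 ^ m)%nat ->
  hierarchical a (2 ^ S m * r + 2 ^ m + i) = hierarchical (dense_seq v) i.
Proof.
  intros Hi; revert a; induction r as [r IH] using lt_wf_ind; intros a.
  destruct (Nat.eq_dec r 0) as [->|Hr].
  - replace (2 ^ S m * 0 + 2 ^ m + i)%nat with (2 ^ m + i)%nat by lia.
    rewrite hierarchical_pow, Hc; auto.
  - destruct (leading_power r) as [k [r' [Er Hr']]]; [lia|].
    assert (Hp : (2 ^ (S m + k) = 2 ^ S m * 2 ^ k)%nat) by apply Nat.pow_add_r.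
    assert (Hs : (2 ^ S m = 2 * 2 ^ m)%nat) by reflexivity.
    replace (2 ^ S m * r + 2 ^ m + i)%nat
      with (2 ^ (S m + k) + (2 ^ S m * r' + 2 ^ m + i))%nat by (subst r; nia).
    rewrite hierarchical_pow by nia. apply IH.
    pose proof (Nat.pow_nonzero 2 k); lia.
Qed.

Lemma hierarchical_uniformly_recurrent b L : exists G, forall a t,
  exists g, (g <= G)%nat /\ forall i, (i < L)%nat ->
    hierarchical a (t + g + i) = hierarchical b i.
Proof.
  destruct (locally_constant_agree _ hierarchical_locally_constant L) as [n Hn].
  destruct (dense_seq_agree b n) as [v Hv].
  destruct (code_constant v L) as [m [Hm Hc]].
  assert (m < 2 ^ m)%nat by (apply Nat.pow_gt_lin_r; lia).
  assert (Hs : (2 ^ S m = 2 * 2 ^ m)%nat) by reflexivity.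
  (* From any time the second half of the next aligned block starts within two block lengths. *)
  exists (2 * 2 ^ S m)%nat; intros a t.
  pose proof (Nat.div_mod t (2 ^ S m)) as Hd.
  pose proof (Nat.mod_upper_bound t (2 ^ S m)) as Hu.
  exists (2 ^ S m * (t / 2 ^ S m + 1) + 2 ^ m - t)%nat; split; [nia|].
  intros i Hi.
  replace (t + (2 ^ S m * (t / 2 ^ S m + 1) + 2 ^ m - t) + i)%nat
    with (2 ^ S m * (t / 2 ^ S m + 1) + 2 ^ m + i)%nat by nia.
  rewrite (hierarchical_at_multiple m v) by (auto; lia).
  apply (Hn b); auto.
Qed.

(** If all these sequences had period [P], each would be determined by its first [P] symbols, hence
    by finitely many bits of the parameter, against injectivity. *)
Lemma hierarchical_not_periodic P : (P > 0)%nat ->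
  exists b t, hierarchical b (t + P) <> hierarchical b t.
Proof.
  intros HP. apply NNPP; intros Hno.
  assert (Hper : forall b t, hierarchical b (t + P) = hierarchical b t).
  { intros b t; apply NNPP; intros H; apply Hno; eauto. }
  destruct (locally_constant_agree _ hierarchical_locally_constant P) as [n Hn].
  assert (E : (fun _ => false) = Nat.eqb n).
  { apply hierarchical_inj; extensionality t.
    induction t as [t IH] using lt_wf_ind.
    destruct (Nat.lt_ge_cases t P) as [H|H].
    - symmetry; revert t H IH; intros t H _. apply (Hn (fun _ => false)); auto.
      intros k Hk. apply Nat.eqb_neq; lia.
    - replace t with (t - P + P)%nat by lia. rewrite !Hper. apply IH; lia. }
  assert (Hf : false = Nat.eqb n n) by (rewrite <- E; reflexivity).
  rewrite Nat.eqb_refl in Hf; discriminate.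
Qed.

(** * Ruler sequences *)

Fixpoint ruler_pos (p : positive) (a : nat -> bool) : bool :=
  match p with xO p' => ruler_pos p' (shift a) | _ => a O end.

(* [ruler a t] is [a] at the 2-adic valuation of [t + 1]. *)
Definition ruler (a : nat -> bool) (t : nat) : bool := ruler_pos (Pos.of_succ_nat t) a.

Lemma ruler_valuation i r t a : (S t = 2 ^ i * (2 * r + 1))%nat -> ruler a t = a i.
Proof.
  unfold ruler.
  assert (H : forall p i a, Pos.to_nat p = (2 ^ i * (2 * r + 1))%nat -> ruler_pos p a = a i).
  { clear; induction p as [p IH|p IH|]; intros i a E.
    - destruct i as [|i]; [reflexivity|].
      rewrite Pos2Nat.inj_xI in E. simpl in E. nia.
    - destruct i as [|i]; [rewrite Pos2Nat.inj_xO in E; simpl in E; lia|].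
      simpl. rewrite (IH i); auto. rewrite Pos2Nat.inj_xO in E. simpl in E; nia.
    - destruct i as [|i]; [reflexivity|].
      change (Pos.to_nat 1) with 1%nat in E. simpl in E. nia. }
  intros E. apply H. rewrite SuccNat2Pos.id_succ. exact E.
Qed.

Lemma ruler_locally_constant t :
  exists L, forall a b, agree L a b -> ruler a t = ruler b t.
Proof.
  unfold ruler. induction (Pos.of_succ_nat t) as [p _|p [L IH]|].
  - exists 1%nat; intros a b H; symmetry; apply H; lia.
  - exists (S L); intros a b H; simpl. apply IH, agree_shift; auto.
  - exists 1%nat; intros a b H; symmetry; apply H; lia.
Qed.

(** If [a] and [b] differ at [i], their ruler sequences differ at each [t] for which [t + 1] has
    valuation [i], and such times form an arithmetic progression of step [2 ^ S i]. *)
Lemma ruler_distal a b : a <> b ->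
  exists G, forall t, exists g, (g <= G)%nat /\ ruler a (t + g) <> ruler b (t + g).
Proof.
  intros H. destruct (first_difference a b H) as [i [_ Hi]].
  exists (2 * 2 ^ S i)%nat; intros t.
  assert (Hs : (2 ^ S i = 2 * 2 ^ i)%nat) by reflexivity.
  assert (Hp : (2 ^ i <> 0)%nat) by (apply Nat.pow_nonzero; lia).
  pose proof (Nat.div_mod t (2 ^ S i)) as Hd.
  pose proof (Nat.mod_upper_bound t (2 ^ S i)) as Hu.
  set (r := (t / 2 ^ S i)%nat) in *.
  (* The term of the progression is taken with [r + 1] rather than [r], so that it is not before [t]
     and the subtraction is not truncated. *)
  exists (2 ^ i * (2 * (r + 1) + 1) - 1 - t)%nat; split; [nia|].
  rewrite !(ruler_valuation i (r + 1)) by nia. auto.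
Qed.

(** * Perfect sets without intervals *)

Lemma closed_last_below (A : R -> Prop) m :
  closed_set A -> ~ A m -> (exists a, A a /\ a < m) ->
  exists p, A p /\ p < m /\ forall z, A z -> z < m -> z <= p.
Proof.
  intros Hc Hm [a [Ha Ham]].
  destruct (completeness (fun z => A z /\ z < m)) as [p [Hub Hlub]].
  - exists m; intros z Hz; lra.
  - exists a; auto.
  - assert (Hpm : p <= m) by (apply Hlub; intros z Hz; lra).
    assert (HAp : A p).
    { apply (Hc p); intros e He. apply NNPP; intros Hno.
      assert (p <= p - e); [|lra]. apply Hlub; intros z Hz.
      apply Rnot_lt_le; intros Hlt; apply Hno; exists z; split; [apply Hz|].
      assert (z <= p) by (apply Hub; auto). apply Rabs_def1; lra. }
    exists p; split; auto; split.
    + destruct Hpm as [H|H]; auto. subst; contradiction.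
    + intros z Hz Hzm; apply Hub; auto.
Qed.

Lemma closed_first_above (A : R -> Prop) m :
  closed_set A -> ~ A m -> (exists a, A a /\ m < a) ->
  exists q, A q /\ m < q /\ forall z, A z -> m < z -> q <= z.
Proof.
  intros Hc Hm [a [Ha Ham]].
  destruct (closed_last_below (fun z => A (- z)) (- m)) as [p [H1 [H2 H3]]].
  - intros x Hx; apply (Hc (- x)); intros e He. destruct (Hx e He) as [y [Hy Hd]].
    exists (- y); split; auto. apply Rabs_def2 in Hd. apply Rabs_def1; lra.
  - rewrite Ropp_involutive; auto.
  - exists (- a); rewrite Ropp_involutive; split; auto; lra.
  - exists (- p); split; auto; split; [lra|]. intros z Hz Hmz.
    assert (- z <= p); [|lra]. apply H3; [rewrite Ropp_involutive; auto|lra].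
Qed.

(** Accumulation from inside at both ends is the invariant of the Cantor scheme below: it prevents a
    split from producing a single point. *)
Definition two_sided_piece (A : R -> Prop) (c : R * R) : Prop :=
  A (fst c) /\ A (snd c) /\ fst c < snd c /\
  (forall e, e > 0 -> exists z, A z /\ fst c < z < fst c + e) /\
  (forall e, e > 0 -> exists z, A z /\ snd c - e < z < snd c).

Section PerfectSets.
Context (A : R -> Prop) (Acl : closed_set A)
  (Aperf : forall x e, A x -> e > 0 -> exists y, A y /\ y <> x /\ Rabs (y - x) < e)
  (Agap : forall u v, u < v -> exists z, u <= z <= v /\ ~ A z).

(** Cut at a point [m] of the middle third outside [A]; the inner ends are the neighbours of [m] in
    [A]. As [A] has no isolated points and nothing of [A] lies in the gap, each inner end is
    approached from its own side. The middle third gives the factor 2/3. *)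
Lemma piece_split c : two_sided_piece A c -> exists d : (R * R) * (R * R),
  two_sided_piece A (fst d) /\ two_sided_piece A (snd d) /\
  fst (fst d) = fst c /\ snd (snd d) = snd c /\ snd (fst d) < fst (snd d) /\
  snd (fst d) - fst (fst d) <= 2 / 3 * (snd c - fst c) /\
  snd (snd d) - fst (snd d) <= 2 / 3 * (snd c - fst c) /\
  (forall z, A z -> z <= snd (fst d) \/ fst (snd d) <= z).
Proof.
  destruct c as [p q]; intros [Hp [Hq [Hpq [Hpr Hql]]]]; simpl in *.
  destruct (Agap (p + (q - p) / 3) (q - (q - p) / 3)) as [m [Hm HAm]]; [lra|].
  destruct (closed_last_below A m Acl HAm) as [p' [H1 [H2 H3]]].
  { exists p; split; auto; lra. }
  destruct (closed_first_above A m Acl HAm) as [q' [H4 [H5 H6]]].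
  { exists q; split; auto; lra. }
  assert (p < p').
  { destruct (Hpr (m - p)) as [z [Hz Hzp]]; [lra|].
    assert (z <= p') by (apply H3; auto; lra). lra. }
  assert (q' < q).
  { destruct (Hql (q - m)) as [z [Hz Hzq]]; [lra|].
    assert (q' <= z) by (apply H6; auto; lra). lra. }
  exists ((p, p'), (q', q)); unfold two_sided_piece; simpl.
  repeat split; auto; try lra.
  - intros e He. pose proof (Rmin_l e (m - p')); pose proof (Rmin_r e (m - p')).
    destruct (Aperf p' (Rmin e (m - p')) H1) as [z [Hz [Hne Hd]]];
      [apply Rmin_glb_lt; lra|].
    apply Rabs_def2 in Hd. exists z; split; auto.
    assert (z <= p') by (apply H3; auto; lra). lra.
  - intros e He. pose proof (Rmin_l e (q' - m)); pose proof (Rmin_r e (q' - m)).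
    destruct (Aperf q' (Rmin e (q' - m)) H4) as [z [Hz [Hne Hd]]];
      [apply Rmin_glb_lt; lra|].
    apply Rabs_def2 in Hd. exists z; split; auto.
    assert (q' <= z) by (apply H6; auto; lra). lra.
  - intros z Hz. destruct (Rtotal_order z m) as [H'|[->|H']].
    + left; auto.
    + contradiction.
    + right; apply H6; auto.
Qed.

(** Repeated splitting of the hull of [A] yields nested pieces with geometrically decreasing
    lengths. Disjoint siblings make the coding injective, closedness puts the limits in [A], and
    every point of [A] has an itinerary because no point of [A] lies in a gap. *)
Lemma cantor_set_of_perfect :
  (forall x, A x -> 0 <= x <= 1) -> (exists x, A x) -> cantor_set A.
Proof.
  intros A01 [x0 Hx0].
  destruct (closed_first_above A (-1)) as [p [Hp [_ Hpmin]]]; auto.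
  { intros H; apply A01 in H; lra. }
  { exists x0; split; auto. apply A01 in Hx0; lra. }
  destruct (closed_last_below A 2) as [q [Hq [_ Hqmax]]]; auto.
  { intros H; apply A01 in H; lra. }
  { exists x0; split; auto. apply A01 in Hx0; lra. }
  assert (Hpz : forall z, A z -> p <= z <= q).
  { intros z Hz; split; [apply Hpmin|apply Hqmax]; auto; apply A01 in Hz; lra. }
  assert (Hroot : two_sided_piece A (p, q)).
  { assert (Hr : forall e, e > 0 -> exists z, A z /\ p < z < p + e).
    { intros e He. destruct (Aperf p e Hp He) as [z [Hz [Hne Hd]]].
      apply Rabs_def2 in Hd. exists z; split; auto. specialize (Hpz z Hz); lra. }
    assert (Hl : forall e, e > 0 -> exists z, A z /\ q - e < z < q).
    { intros e He. destruct (Aperf q e Hq He) as [z [Hz [Hne Hd]]].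
      apply Rabs_def2 in Hd. exists z; split; auto. specialize (Hpz z Hz); lra. }
    split; [|split; [|split; [|split]]]; auto; simpl.
    destruct (Hr 1) as [z [Hz Hz']]; [lra|]. specialize (Hpz z Hz); lra. }
  destruct (choice_any (fun c d => two_sided_piece A c ->
    two_sided_piece A (fst d) /\ two_sided_piece A (snd d) /\
    fst (fst d) = fst c /\ snd (snd d) = snd c /\ snd (fst d) < fst (snd d) /\
    snd (fst d) - fst (fst d) <= 2 / 3 * (snd c - fst c) /\
    snd (snd d) - fst (snd d) <= 2 / 3 * (snd c - fst c) /\
    (forall z, A z -> z <= snd (fst d) \/ fst (snd d) <= z))) as [split2 Hs].
  { intros c. destruct (classic (two_sided_piece A c)) as [H|H].
    - destruct (piece_split c H) as [d Hd]; exists d; auto.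
    (* An arbitrary value for pairs that are not pieces. *)
    - exists ((0, 0), (0, 0)); intros H'; contradiction. }
  pose (next := fun (k : nat) c (b : bool) => if b then snd (split2 c) else fst (split2 c)).
  pose (nd := branch next (p, q)).
  assert (Hsucc : forall k s, nd (S k) s = next k (nd k s) (s k)) by reflexivity.
  assert (Hgood : forall k s, two_sided_piece A (nd k s)).
  { induction k as [|k IH]; intros s; [exact Hroot|]. rewrite Hsucc; unfold next.
    destruct (Hs _ (IH s)) as [H1 [H2 _]]. destruct (s k); auto. }
  assert (Hnest : forall k s, fst (nd k s) <= fst (nd (S k) s) /\
    snd (nd (S k) s) <= snd (nd k s) /\
    snd (nd (S k) s) - fst (nd (S k) s) <= 2 / 3 * (snd (nd k s) - fst (nd k s))).
  { intros k s. rewrite Hsucc; unfold next.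
    destruct (Hs _ (Hgood k s)) as [[_ [_ [H1 _]]] [[_ [_ [H2 _]]] [H3 [H4 [H5 [H6 [H7 _]]]]]]].
    destruct (s k); lra. }
  assert (Hnest' : forall k j s, (k <= j)%nat ->
    fst (nd k s) <= fst (nd j s) /\ snd (nd j s) <= snd (nd k s)).
  { intros k j s H; induction H as [|j H IH]; [lra|]. pose proof (Hnest j s); lra. }
  assert (Hlt : forall k s, fst (nd k s) < snd (nd k s)).
  { intros k s; apply (Hgood k s). }
  assert (Hlen : forall k s, snd (nd k s) - fst (nd k s) <= (2 / 3) ^ k * (q - p)).
  { induction k as [|k IH]; intros s; simpl.
    - lra.
    - pose proof (Hnest k s); specialize (IH s); lra. }
  assert (Hf : forall s, exists x, forall k, fst (nd k s) <= x <= snd (nd k s)).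
  { intros s. destruct (completeness (fun v => exists k, fst (nd k s) = v)) as [x [Hub Hlub]].
    - exists q; intros v [k <-]. pose proof (Hnest' O k s (Nat.le_0_l k)).
      pose proof (Hlt k s). simpl in *; lra.
    - exists (fst (nd O s)); eauto.
    - exists x; intros k; split; [apply Hub; eauto|].
      apply Hlub; intros v [j <-].
      pose proof (Hlt (Nat.max k j) s).
      pose proof (Hnest' k (Nat.max k j) s ltac:(lia)).
      pose proof (Hnest' j (Nat.max k j) s ltac:(lia)). lra. }
  destruct (choice_any _ Hf) as [f Hfs].
  assert (Hsmall : forall e, e > 0 -> exists k, (2 / 3) ^ k * (q - p) < e).
  { intros e He. assert (Hpq : p < q) by apply Hroot.
    destruct (pow_lt_1_zero (2 / 3)) with (y := e / (q - p)) as [k Hk].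
    - rewrite Rabs_right; lra.
    - apply Rdiv_lt_0_compat; lra.
    - exists k. specialize (Hk k (le_n k)).
      rewrite Rabs_right in Hk by (left; apply pow_lt; lra).
      apply Rmult_lt_compat_r with (r := q - p) in Hk; [|lra].
      unfold Rdiv in Hk. rewrite (Rmult_assoc e), Rinv_l in Hk by lra. lra. }
  exists f; split; [|split].
  - intros a e He. destruct (Hsmall e He) as [k Hk].
    exists k; intros b Hb.
    assert (Hnd : nd k b = nd k a) by (apply branch_agree; auto).
    pose proof (Hfs a k); pose proof (Hfs b k) as Hbk. rewrite Hnd in Hbk.
    pose proof (Hlen k a). apply Rabs_def1; lra.
  - intros a b Hab. apply NNPP; intros Hne.
    destruct (first_difference a b Hne) as [k [Hk Hd]].
    assert (Hnd : nd k b = nd k a) by (apply branch_agree; auto).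
    pose proof (Hfs a (S k)) as Ha; pose proof (Hfs b (S k)) as Hb.
    rewrite Hsucc in Ha, Hb. rewrite Hnd, <- Hab in Hb. unfold next in *.
    destruct (Hs _ (Hgood k a)) as [_ [_ [_ [_ [H5 _]]]]].
    destruct (a k), (b k); try congruence; lra.
  - intros y; split.
    + intros Hy.
      (* The itinerary of [y]: go right exactly when [y] is not before the left end of the right
         half. *)
      pose (side := fun c => if Rle_dec (fst (snd (split2 c))) y then true else false).
      pose (path := fix path k := match k with O => (p, q)
        | S k' => next k' (path k') (side (path k')) end).
      exists (fun k => side (path k)).
      assert (Hpath : forall k, nd k (fun k => side (path k)) = path k).
      { induction k as [|k IH]; [reflexivity|]. rewrite Hsucc, IH. reflexivity. }
      assert (Hin : forall k, fst (path k) <= y <= snd (path k)).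
      { induction k as [|k IH]; [simpl; auto|].
        pose proof (Hgood k (fun k => side (path k))) as Hg. rewrite Hpath in Hg.
        destruct (Hs _ Hg) as [_ [_ [H3 [H4 [_ [_ [_ H8]]]]]]].
        change (path (S k)) with (next k (path k) (side (path k))).
        unfold next, side. destruct (Rle_dec (fst (snd (split2 (path k)))) y) as [H|H].
        - lra.
        - destruct (H8 y Hy); [lra|contradiction]. }
      apply Rminus_diag_uniq. apply NNPP; intros Hne.
      destruct (Hsmall (Rabs (f (fun k => side (path k)) - y))) as [k Hk].
      { apply Rabs_pos_lt; auto. }
      pose proof (Hlen k (fun k => side (path k))) as Hl.
      pose proof (Hfs (fun k => side (path k)) k) as Hfk.
      rewrite Hpath in *. specialize (Hin k).
      assert (Rabs (f (fun k => side (path k)) - y) <= (2 / 3) ^ k * (q - p)); [|lra].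
      apply Rabs_le; lra.
    + intros [s <-]. apply (Acl (f s)); intros e He. destruct (Hsmall e He) as [k Hk].
      exists (fst (nd k s)); split; [apply Hgood|].
      pose proof (Hfs s k); pose proof (Hlen k s). apply Rabs_def1; lra.
Qed.
End PerfectSets.
(** * Interval dynamics *)

(** Composing with this retraction turns continuity on [0,1] into continuity on the line, so that
    the Heine theorem and [IVT] apply. *)
Definition clamp (x : R) : R := Rmax 0 (Rmin 1 x).

Lemma clamp_I01 x : I01 (clamp x).
Proof.
  unfold clamp, I01. split; [apply Rmax_l|].
  apply Rmax_lub; [lra|apply Rmin_l].
Qed.

Lemma clamp_id x : I01 x -> clamp x = x.
Proof.
  unfold clamp, I01; intros H. rewrite Rmin_right, Rmax_right; lra.
Qed.

Lemma clamp_contraction x y : Rabs (clamp y - clamp x) <= Rabs (y - x).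
Proof.
  unfold clamp, Rmax, Rmin, Rabs.
  repeat destruct (Rle_dec _ _); repeat destruct (Rcase_abs _); lra.
Qed.

Lemma continuous01_clamp F : continuous01 F -> continuity (fun x => F (clamp x)).
Proof.
  intros HF x e He. destruct (HF (clamp x) (clamp_I01 x) e He) as [d [Hd H]].
  exists d; split; auto. intros y [_ Hy]. simpl in *; unfold R_dist in *.
  apply H; [apply clamp_I01|]. pose proof (clamp_contraction x y); lra.
Qed.

Lemma continuous01_uniform F : continuous01 F -> forall e, e > 0 ->
  exists d, d > 0 /\ forall x y, I01 x -> I01 y -> Rabs (x - y) < d -> Rabs (F x - F y) < e.
Proof.
  intros HF e He.
  destruct (Heine (fun x => F (clamp x)) (fun c => 0 <= c <= 1)) with (1 := compact_P3 0 1)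
    (eps := mkposreal e He) as [d H].
  - intros x _; apply continuous01_clamp; auto.
  - exists d; split; [apply cond_pos|]. intros x y Hx Hy Hxy.
    specialize (H x y Hx Hy Hxy). rewrite !clamp_id in H; auto.
Qed.

Lemma continuous01_IVT F u v y : continuous01 F -> I01 u -> I01 v -> u <= v ->
  F u <= y <= F v \/ F v <= y <= F u -> exists x, u <= x <= v /\ F x = y.
Proof.
  intros HF Hu Hv Huv Hy.
  destruct (Req_dec (F u) y) as [E|E]; [exists u; split; auto; lra|].
  destruct (Req_dec (F v) y) as [E'|E']; [exists v; split; auto; lra|].
  assert (Hlt : u < v) by (destruct Huv as [H|H]; auto; subst; lra).
  pose proof (continuous01_clamp F HF) as Hc.
  destruct Hy as [Hy|Hy].
  - destruct (IVT (fun x => F (clamp x) - y) u v) as [z [Hz Ez]]; auto.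
    + apply continuity_minus; auto. apply continuity_const; intros a b; auto.
    + rewrite clamp_id by auto; lra.
    + rewrite clamp_id by auto; lra.
    + exists z; split; auto. rewrite clamp_id in Ez; [lra|]. unfold I01 in *; lra.
  - destruct (IVT (fun x => y - F (clamp x)) u v) as [z [Hz Ez]]; auto.
    + apply continuity_minus; auto. apply continuity_const; intros a b; auto.
    + rewrite clamp_id by auto; lra.
    + rewrite clamp_id by auto; lra.
    + exists z; split; auto. rewrite clamp_id in Ez; [lra|]. unfold I01 in *; lra.
Qed.

Lemma iter_add T m n x : iter (m + n) T x = iter m T (iter n T x).
Proof. induction m as [|m IH]; simpl; congruence. Qed.

Lemma iter_mul T m n x : iter (m * n) T x = iter m (iter n T) x.
Proof. induction m as [|m IH]; simpl; auto. rewrite iter_add, IH; auto. Qed.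

Lemma iter_self_map T n : self_map01 T -> self_map01 (iter n T).
Proof. intros H x Hx; induction n as [|n IH]; simpl; auto. Qed.

Lemma iter_continuous T n : self_map01 T -> continuous01 T -> continuous01 (iter n T).
Proof.
  intros Hs Hc; induction n as [|n IH]; intros x Hx e He.
  - exists e; auto.
  - simpl. destruct (Hc (iter n T x) (iter_self_map T n Hs x Hx) e He) as [d [Hd H]].
    destruct (IH x Hx d Hd) as [d' [Hd' H']].
    exists d'; split; auto. intros y Hy Hyx. apply H; auto. apply iter_self_map; auto.
Qed.

Lemma iter_uniform T G e : self_map01 T -> continuous01 T -> e > 0 ->
  exists d, d > 0 /\ forall g, (g <= G)%nat -> forall x y, I01 x -> I01 y ->
    Rabs (x - y) < d -> Rabs (iter g T x - iter g T y) < e.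
Proof.
  intros Hs Hc He.
  destruct (bound_below_R (fun g d => forall x y, I01 x -> I01 y ->
    Rabs (x - y) < d -> Rabs (iter g T x - iter g T y) < e) (S G)) as [d [Hd H]].
  - intros i d d' Hd H x y Hx Hy Hxy; apply H; auto; lra.
  - intros i _. apply continuous01_uniform; auto. apply iter_continuous; auto.
  - exists d; split; auto. intros g Hg; apply H; lia.
Qed.

Definition covers (F : R -> R) (J K : R * R) : Prop :=
  forall y, fst K <= y <= snd K -> exists x, fst J <= x <= snd J /\ F x = y.

(** By mixing, for all large [n] the image of the open interval meets both [[0, al)] and [(be, 1]];
    intermediate values fill the rest. The bounds on [al] and [be] make these two sets nonempty. *)
Lemma mixing_covers T u v al be :
  self_map01 T -> continuous01 T -> top_mixing T ->
  0 <= u -> u < v -> v <= 1 -> 0 < al -> be < 1 ->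
  exists N, forall n, (n >= N)%nat -> covers (iter n T) (u, v) (al, be).
Proof.
  intros Hs Hc Hm Hu Huv Hv Hal Hbe.
  pose (U := fun x => u < x < v).
  assert (HU : open01 U).
  { split; [intros x Hx; unfold U, I01 in *; lra|].
    intros x [H1 H2]. exists (Rmin (x - u) (v - x)); split; [apply Rmin_glb_lt; lra|].
    intros y _ Hy. pose proof (Rmin_l (x - u) (v - x)); pose proof (Rmin_r (x - u) (v - x)).
    apply Rabs_def2 in Hy; unfold U; lra. }
  assert (HU' : exists x, U x) by (exists ((u + v) / 2); unfold U; lra).
  destruct (Hm U (fun x => 0 <= x <= 1 /\ x < al)) as [N1 H1]; auto.
  { split; [intros x [Hx _]; auto|]. intros x [H1 H2].
    exists (al - x); split; [lra|]. intros y Hy Hd; unfold I01 in Hy.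
    apply Rabs_def2 in Hd; lra. }
  { exists 0; lra. }
  destruct (Hm U (fun x => 0 <= x <= 1 /\ be < x)) as [N2 H2]; auto.
  { split; [intros x [Hx _]; auto|]. intros x [H2 H3].
    exists (x - be); split; [lra|]. intros y Hy Hd; unfold I01 in Hy.
    apply Rabs_def2 in Hd; lra. }
  { exists 1; lra. }
  exists (N1 + N2)%nat; intros n Hn y Hy; simpl in *.
  destruct (H1 n) as [x1 [Hx1 [_ Hy1]]]; [lia|].
  destruct (H2 n) as [x2 [Hx2 [_ Hy2]]]; [lia|].
  unfold U in *.
  pose proof (iter_continuous T n Hs Hc) as Hcn.
  destruct (Rle_or_lt x1 x2) as [H|H].
  - destruct (continuous01_IVT (iter n T) x1 x2 y) as [x [Hx Ex]]; auto;
      unfold I01; try lra. exists x; split; auto; lra.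
  - destruct (continuous01_IVT (iter n T) x2 x1 y) as [x [Hx Ex]]; auto;
      unfold I01; try lra. exists x; split; auto; lra.
Qed.

(** * Horseshoes *)

Definition subinterval (K J : R * R) : Prop := fst J <= fst K /\ snd K <= snd J.

Definition maps_onto (F : R -> R) (J K : R * R) : Prop :=
  covers F J K /\ forall x, fst J <= x <= snd J -> fst K <= F x <= snd K.

Lemma continuous01_closed_level F c : continuous01 F ->
  forall x, I01 x -> (forall e, e > 0 -> exists y, I01 y /\ F y = c /\ Rabs (x - y) < e) -> F x = c.
Proof.
  intros HF x Hx H. apply NNPP; intros Hne.
  assert (He : Rabs (F x - c) > 0) by (apply Rabs_pos_lt; lra).
  destruct (HF x Hx _ He) as [d [Hd Hcl]].
  destruct (H d Hd) as [y [Hy [Ey Hxy]]].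
  assert (Hlt : Rabs (F y - F x) < Rabs (F x - c)).
  { apply Hcl; auto. rewrite Rabs_minus_sym; auto. }
  rewrite Ey, Rabs_minus_sym in Hlt; lra.
Qed.

(* From a point of level [c] and a later point of level [d], pass to the last
   [c]-point and then to the first [d]-point after it. *)
Lemma last_first_level F p r c d : continuous01 F -> 0 <= p -> p <= r -> r <= 1 ->
  c <> d -> F p = c -> F r = d ->
  exists u v, p <= u /\ u < v /\ v <= r /\ F u = c /\ F v = d /\
    (forall x, u < x <= v -> F x <> c) /\ (forall x, u <= x < v -> F x <> d).
Proof.
  intros HF Hp Hpr Hr Hcd Fp Fr.
  destruct (completeness (fun x => p <= x <= r /\ F x = c)) as [u [Hub Hlub]].
  { exists r; intros x Hx; lra. }
  { exists p; split; auto; lra. }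
  assert (Hu1 : p <= u) by (apply Hub; split; auto; lra).
  assert (Hu2 : u <= r) by (apply Hlub; intros x Hx; lra).
  assert (Fu : F u = c).
  { apply continuous01_closed_level; auto; [unfold I01; lra|]. intros e He.
    apply NNPP; intros Hno. assert (u <= u - e); [|lra].
    apply Hlub; intros x [Hx Ex]. apply Rnot_lt_le; intros Hlt; apply Hno.
    assert (x <= u) by (apply Hub; auto).
    exists x; unfold I01; repeat split; try lra. apply Rabs_def1; lra. }
  destruct (completeness (fun z => u <= - z <= r /\ F (- z) = d)) as [w [Hub' Hlub']].
  { exists (- u); intros x Hx; lra. }
  { exists (- r); rewrite Ropp_involutive; split; auto; lra. }
  assert (Hw1 : - r <= w) by (apply Hub'; rewrite Ropp_involutive; split; auto; lra).
  assert (Hw2 : w <= - u) by (apply Hlub'; intros x Hx; lra).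
  assert (Fw : F (- w) = d).
  { apply continuous01_closed_level; auto; [unfold I01; lra|]. intros e He.
    apply NNPP; intros Hno. assert (w <= w - e); [|lra].
    apply Hlub'; intros x [Hx Ex]. apply Rnot_lt_le; intros Hlt; apply Hno.
    assert (x <= w) by (apply Hub'; auto).
    exists (- x); unfold I01; repeat split; try lra. apply Rabs_def1; lra. }
  exists u, (- w).
  assert (u <> - w) by (intros E; rewrite E in Fu; congruence).
  repeat split; auto; try lra.
  - intros x Hx Ex. assert (x <= u); [|lra]. apply Hub; split; auto; lra.
  - intros x Hx Ex. assert (- x <= w); [|lra].
    apply Hub'; rewrite Ropp_involutive; split; auto; lra.
Qed.

(** Between a last point of one end level and the first following point of the other, the values
    cannot leave [K]: leaving and coming back would cross an end level once more. The two cases are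
    the two orders in which the ends of [K] are attained. *)
Lemma covers_shrink F J K : continuous01 F ->
  0 <= fst J -> snd J <= 1 -> fst K < snd K -> covers F J K ->
  exists L, subinterval L J /\ fst L < snd L /\ maps_onto F L K.
Proof.
  destruct J as [j1 j2], K as [c d]; simpl; intros HF Hj1 Hj2 Hcd Hcov.
  destruct (Hcov c) as [p [Hp Fp]]; [simpl; lra|].
  destruct (Hcov d) as [r [Hr Fr]]; [simpl; lra|].
  simpl in Hp, Hr. unfold subinterval, maps_onto, covers.
  destruct (Rle_or_lt p r) as [Hpr|Hpr].
  - destruct (last_first_level F p r c d) as [u [v [H1 [H2 [H3 [Fu [Fv [Hc Hd]]]]]]]];
      auto; try lra.
    exists (u, v); simpl; repeat split; try lra.
    + intros y Hy. apply continuous01_IVT; unfold I01; auto; lra.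
    + apply Rnot_lt_le; intros Hlt.
      destruct (continuous01_IVT F x v c) as [z [Hz Ez]]; unfold I01; auto; try lra.
      apply (Hc z); auto. assert (x <> u) by (intros ->; lra). lra.
    + apply Rnot_lt_le; intros Hlt.
      destruct (continuous01_IVT F u x d) as [z [Hz Ez]]; unfold I01; auto; try lra.
      apply (Hd z); auto. assert (x <> v) by (intros ->; lra). lra.
  - destruct (last_first_level F r p d c) as [u [v [H1 [H2 [H3 [Fu [Fv [Hd Hc]]]]]]]];
      auto; try lra.
    exists (u, v); simpl; repeat split; try lra.
    + intros y Hy. apply continuous01_IVT; unfold I01; auto; lra.
    + apply Rnot_lt_le; intros Hlt.
      destruct (continuous01_IVT F u x c) as [z [Hz Ez]]; unfold I01; auto; try lra.
      apply (Hc z); auto. assert (x <> v) by (intros ->; lra). lra.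
    + apply Rnot_lt_le; intros Hlt.
      destruct (continuous01_IVT F x v d) as [z [Hz Ez]]; unfold I01; auto; try lra.
      apply (Hd z); auto. assert (x <> u) by (intros ->; lra). lra.
Qed.

(** For each [s] nested intervals [J n s] are chosen so that [F] maps [J (S n) s] onto
    [J n (shift s)]. Their intersection is one point, which is [x s], and the conjugacy with the
    shift follows. *)
Lemma horseshoe T : self_map01 T -> continuous01 T -> top_mixing T ->
  exists (N : nat) (x : (nat -> bool) -> R), (N > 0)%nat /\ cantor_continuous x /\
    (forall s, 1 / 4 <= x s <= 3 / 4) /\
    (forall s, iter N T (x s) = x (shift s)) /\
    (forall s s', s O <> s' O -> Rabs (x s - x s') >= 1 / 4).
Proof.
  intros Hs Hc Hm.
  (* Two intervals at distance 1/4, each of which will cover [1/4, 3/4] and hence both of them. *)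
  pose (K := fun b : bool => if b then (5 / 8, 3 / 4) else (1 / 4, 3 / 8)).
  destruct (mixing_covers T (1 / 4) (3 / 8) (1 / 4) (3 / 4)) as [N0 HN0]; auto; try lra.
  destruct (mixing_covers T (5 / 8) (3 / 4) (1 / 4) (3 / 4)) as [N1 HN1]; auto; try lra.
  pose (N := (N0 + N1 + 1)%nat).
  pose (F := iter N T).
  assert (HF : continuous01 F) by (apply iter_continuous; auto).
  destruct (choice_any (fun (JK : (R * R) * (R * R)) L =>
    0 <= fst (fst JK) -> snd (fst JK) <= 1 -> fst (snd JK) < snd (snd JK) ->
    covers F (fst JK) (snd JK) ->
    subinterval L (fst JK) /\ fst L < snd L /\ maps_onto F L (snd JK))) as [shrink Hsh].
  { intros [J L].
    destruct (classic (0 <= fst J /\ snd J <= 1 /\ fst L < snd L /\ covers F J L))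
      as [[H1 [H2 [H3 H4]]]|H].
    - destruct (covers_shrink F J L) as [M HM]; auto. exists M; auto.
    - exists (0, 0); intros; exfalso; apply H; auto. }
  pose (J := fix J (n : nat) (s : nat -> bool) : R * R :=
    match n with O => K (s O) | S n' => shrink (J n' s, J n' (shift s)) end).
  assert (HJ : forall n s, 1 / 4 <= fst (J n s) /\ fst (J n s) < snd (J n s) /\
    snd (J n s) <= 3 / 4 /\ covers F (J n s) (J n (shift s))).
  { assert (Hstep : forall n s,
      (forall s, 1 / 4 <= fst (J n s) /\ fst (J n s) < snd (J n s) /\
         snd (J n s) <= 3 / 4 /\ covers F (J n s) (J n (shift s))) ->
      subinterval (J (S n) s) (J n s) /\ fst (J (S n) s) < snd (J (S n) s) /\
      maps_onto F (J (S n) s) (J n (shift s))).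
    { intros n s H. apply (Hsh (J n s, J n (shift s))); simpl.
      - destruct (H s); lra.
      - destruct (H s); lra.
      - apply H.
      - apply H. }
    induction n as [|n IH]; intros s.
    - assert (HK : forall b, 1 / 4 <= fst (K b) /\ fst (K b) < snd (K b) /\ snd (K b) <= 3 / 4).
      { intros []; simpl; lra. }
      change (J O s) with (K (s O)). change (J O (shift s)) with (K (s 1%nat)).
      repeat split; try apply HK. intros y Hy. pose proof (HK (s 1%nat)).
      destruct (s O); simpl.
      + apply (HN1 N); [unfold N; lia|simpl; lra].
      + apply (HN0 N); [unfold N; lia|simpl; lra].
    - destruct (Hstep n s IH) as [[H1 H2] [H3 [H4 _]]].
      destruct (Hstep n (shift s) IH) as [[H5 H6] _].
      destruct (IH s) as [H7 [_ [H8 _]]].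
      split; [lra|]. split; [auto|]. split; [lra|].
      intros y Hy. apply H4. lra. }
  assert (Hsub : forall n s, subinterval (J (S n) s) (J n s) /\
      maps_onto F (J (S n) s) (J n (shift s))).
  { intros n s. destruct (HJ n s) as [H1 [H2 [H3 H4]]].
    destruct (HJ n (shift s)) as [_ [H5 _]].
    destruct (Hsh (J n s, J n (shift s))) as [H6 [_ H7]]; simpl; auto; lra. }
  assert (Hnest : forall n m s, (n <= m)%nat -> subinterval (J m s) (J n s)).
  { intros n m s H; induction H as [|m H IH]; unfold subinterval in *; [lra|].
    destruct (Hsub m s) as [[H1 H2] _]; lra. }
  assert (Hloc : forall n s s', agree (S n) s s' -> J n s' = J n s).
  { induction n as [|n IH]; intros s s' H.
    - simpl. rewrite H; auto.
    - simpl. rewrite (IH s s'), (IH (shift s) (shift s')); auto.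
      + apply agree_shift; auto.
      + apply agree_le with (S (S n)); auto. }
  assert (Hx : forall s, exists x, (forall n, fst (J n s) <= x) /\
    forall b, (forall n, fst (J n s) <= b) -> x <= b).
  { intros s. destruct (completeness (fun v => exists n, fst (J n s) = v)) as [x [Hub Hlub]].
    - exists (3 / 4); intros v [n <-]. destruct (HJ n s) as [H1 [H2 [H3 _]]]; lra.
    - exists (fst (J O s)); eauto.
    - exists x; split; [intros n; apply Hub; eauto|].
      intros b Hb; apply Hlub; intros v [n <-]; auto. }
  destruct (choice_any _ Hx) as [x Hxl].
  (* With [e = 0] this puts [x s] in all the intervals; with [e > 0] it puts all of [[x s, x s + e]]
     there, which is then refuted. *)
  assert (Hub : forall s e, (forall n, e <= snd (J n s) - fst (J n s)) ->
    forall n, x s + e <= snd (J n s)).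
  { intros s e He n. assert (x s <= snd (J n s) - e); [|lra].
    apply Hxl; intros m. specialize (He (Nat.max n m)).
    destruct (Hnest n (Nat.max n m) s) as [_ H1]; [lia|].
    destruct (Hnest m (Nat.max n m) s) as [H2 _]; [lia|]. lra. }
  assert (Hxs : forall s n, fst (J n s) <= x s <= snd (J n s)).
  { intros s n; split; [apply Hxl|]. rewrite <- (Rplus_0_r (x s)). apply Hub.
    intros m; destruct (HJ m s) as [_ [H _]]; lra. }
  assert (Htrack : forall t s z, fst (J t s) <= z <= snd (J t s) ->
    fst (K (s t)) <= iter t F z <= snd (K (s t))).
  { induction t as [|t IH]; intros s z Hz; [auto|].
    replace (S t) with (t + 1)%nat at 2 3 by lia. rewrite iter_add.
    apply (IH (shift s)). apply (Hsub t s); auto. }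
  (* A nondegenerate intersection would be a wandering interval, which mixing forbids. *)
  assert (Hlen : forall s e, e > 0 -> exists n, snd (J n s) - fst (J n s) < e).
  { intros s e He. apply NNPP; intros Hno.
    assert (Hge : forall n, snd (J n s) - fst (J n s) >= e).
    { intros n; apply Rnot_lt_ge; intros H; apply Hno; eauto. }
    assert (Hin : forall n, x s + e <= snd (J n s)).
    { apply Hub; intros n; specialize (Hge n); lra. }
    destruct (HJ O s) as [HJ1 [_ [HJ2 _]]].
    pose proof (Hin O); pose proof (Hxs s O).
    destruct (mixing_covers T (x s) (x s + e) (1 / 4) (3 / 4)) as [N2 HN2]; auto; try lra.
    assert (Hcov : covers (iter N2 F) (x s, x s + e) (1 / 4, 3 / 4)).
    { intros y Hy. destruct (HN2 (N2 * N)%nat) with (y := y) as [z [Hz Ez]]; auto.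
      - unfold N; nia.
      - exists z; split; auto. unfold F; rewrite <- iter_mul; auto. }
    destruct (Hcov (1 / 4)) as [z1 [Hz1 E1]]; [simpl; lra|].
    destruct (Hcov (3 / 4)) as [z2 [Hz2 E2]]; [simpl; lra|]. simpl in Hz1, Hz2.
    pose proof (Hxs s N2); specialize (Hin N2).
    pose proof (Htrack N2 s z1 ltac:(lra)) as T1.
    pose proof (Htrack N2 s z2 ltac:(lra)) as T2.
    rewrite E1 in T1; rewrite E2 in T2. unfold K in T1, T2; destruct (s N2); simpl in *; lra. }
  exists N, x; split; [unfold N; lia|split; [|split; [|split]]].
  - intros s e He. destruct (Hlen s e He) as [n Hn]. exists (S n); intros b Hb.
    pose proof (Hxs s n); pose proof (Hxs b n) as Hb'. rewrite (Hloc n s b Hb) in Hb'.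
    apply Rabs_def1; lra.
  - intros s. pose proof (Hxs s O). destruct (HJ O s) as [H1 [_ [H2 _]]]; lra.
  - intros s. fold F.
    assert (Hin : forall n, fst (J n (shift s)) <= F (x s) <= snd (J n (shift s))).
    { intros n. apply (Hsub n s), Hxs. }
    apply Rminus_diag_uniq. apply NNPP; intros Hne.
    destruct (Hlen (shift s) (Rabs (F (x s) - x (shift s)))) as [n Hn].
    { apply Rabs_pos_lt; auto. }
    specialize (Hin n); pose proof (Hxs (shift s) n).
    assert (Rabs (F (x s) - x (shift s)) <= snd (J n (shift s)) - fst (J n (shift s)));
      [|lra]. apply Rabs_le; lra.
  - intros s s' Hss. pose proof (Hxs s O) as H1; pose proof (Hxs s' O) as H2.
    change (J O s) with (K (s O)) in H1. change (J O s') with (K (s' O)) in H2.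
    unfold K in H1, H2. apply Rle_ge. destruct (s O), (s' O); simpl in *; try congruence.
    + rewrite Rabs_right; lra.
    + rewrite Rabs_left; lra.
Qed.

(** * Spreading a Cantor family over the interval *)

Lemma interval_basis : exists I : nat -> R * R,
  (forall k, 0 < fst (I k) /\ fst (I k) < snd (I k) /\ snd (I k) < 1) /\
  (forall u v, 0 <= u -> u < v -> v <= 1 -> exists k, u < fst (I k) /\ snd (I k) < v).
Proof.
  (* The middle third of the [j]-th cell of the grid of mesh [1 / (n + 1)]; pairs with [j > n] get a
     default interval. *)
  exists (fun k => let (n, j) := Cantor.of_nat k in
    if le_lt_dec (S n) j then (1 / 3, 2 / 3)
    else ((INR j + 1 / 3) / INR (S n), (INR j + 2 / 3) / INR (S n))).
  split.
  - intros k. destruct (Cantor.of_nat k) as [n j].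
    assert (Hn : 0 < INR (S n)) by (apply lt_0_INR; lia).
    destruct (le_lt_dec (S n) j) as [H|H]; cbn [fst snd]; [lra|].
    pose proof (pos_INR j). apply le_INR in H. rewrite !S_INR in H.
    rewrite S_INR in Hn. rewrite S_INR. split; [|split].
    + apply Rdiv_lt_0_compat; lra.
    + apply Rmult_lt_compat_r; [apply Rinv_0_lt_compat; auto|lra].
    + apply Rmult_lt_reg_r with (INR n + 1); auto. unfold Rdiv.
      rewrite Rmult_assoc, Rinv_l; lra.
  - intros u v Hu Huv Hv.
    destruct (archimed_inv ((v - u) / 2)) as [n Hn]; [lra|].
    assert (Hp : 0 < INR (S n)) by (apply lt_0_INR; lia).
    assert (Hn2 : 2 < (v - u) * INR (S n)).
    { apply Rmult_lt_compat_r with (r := INR (S n)) in Hn; auto.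
      rewrite Rinv_l in Hn; lra. }
    (* The first grid point not before [u]; two meshes fit in [v - u], so the cell that starts there
       ends before [v]. *)
    destruct (min_nat (fun j => u * INR (S n) <= INR j)) as [j [Hj Hmin]].
    { destruct (INR_unbounded (u * INR (S n))) as [j Hj]; exists j; lra. }
    assert (Hj2 : INR j < u * INR (S n) + 1).
    { destruct j as [|j].
      - change (INR 0) with 0. assert (0 <= u * INR (S n)) by (apply Rmult_le_pos; lra). lra.
      - rewrite S_INR. specialize (Hmin j (Nat.lt_succ_diag_r j)). lra. }
    assert (Hjn : (j < S n)%nat) by (apply INR_lt; nra).
    exists (Cantor.to_nat (n, j)). rewrite Cantor.cancel_of_to.
    destruct (le_lt_dec (S n) j) as [H|H]; [lia|]. cbn [fst snd]. split.
    + apply Rmult_lt_reg_r with (INR (S n)); auto. unfold Rdiv.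
      rewrite Rmult_assoc, Rinv_l; lra.
    + apply Rmult_lt_reg_r with (INR (S n)); auto. unfold Rdiv.
      rewrite Rmult_assoc, Rinv_l; lra.
Qed.

(** The word of [k] ones and a zero, followed by [s]. These cylinders reserve disjoint copies of the
    Cantor space for the different [k]. *)
Definition tag (k : nat) (s : nat -> bool) : nat -> bool :=
  fun i => if lt_eq_lt_dec i k then Nat.ltb i k else s (i - S k)%nat.

Lemma tag_below k s i : (i < k)%nat -> tag k s i = true.
Proof.
  intros H; unfold tag. destruct (lt_eq_lt_dec i k); [apply Nat.ltb_lt; auto|lia].
Qed.

Lemma tag_at k s : tag k s k = false.
Proof.
  unfold tag. destruct (lt_eq_lt_dec k k); [apply Nat.ltb_irrefl|lia].
Qed.

Lemma tag_above k s i : tag k s (S k + i) = s i.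
Proof.
  unfold tag. destruct (lt_eq_lt_dec (S k + i) k) as [[H|H]|H]; try lia.
  f_equal; lia.
Qed.

Lemma tag_inj k k' s s' : tag k s = tag k' s' -> k = k' /\ s = s'.
Proof.
  intros H.
  assert (Hle : forall k k' s s', tag k s = tag k' s' -> (k' <= k)%nat).
  { clear; intros k k' s s' H. apply Nat.le_ngt; intros Hlt.
    pose proof (tag_below k' s' k Hlt) as H1. rewrite <- H, tag_at in H1. discriminate. }
  assert (k = k') by (apply Nat.le_antisymm; eapply Hle; eauto).
  subst k'; split; auto. extensionality i. rewrite <- (tag_above k s), H. apply tag_above.
Qed.

Lemma tag_agree k n s s' : agree n s s' -> agree n (tag k s) (tag k s').
Proof.
  intros H i Hi. unfold tag. destruct (lt_eq_lt_dec i k); auto. apply H; lia.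
Qed.

Lemma cantor_continuous_comp (x : (nat -> bool) -> R) (F : (nat -> bool) -> nat -> bool) :
  cantor_continuous x -> (forall n, exists L, forall a b, agree L a b -> agree n (F a) (F b)) ->
  cantor_continuous (fun a => x (F a)).
Proof.
  intros Hx HF a e He. destruct (Hx (F a) e He) as [n Hn].
  destruct (HF n) as [L HL]. exists L; intros b Hb. apply Hn, HL; auto.
Qed.

Lemma cantor_set_range f : cantor_continuous f -> (forall a b, f a = f b -> a = b) ->
  cantor_set (fun y => exists a, f a = y).
Proof. intros Hc Hi; exists f; split; [auto|split; auto]. intros y; tauto. Qed.

Lemma iter_eq_later T x y n k : iter n T x = iter n T y -> (n <= k)%nat ->
  iter k T x = iter k T y.
Proof.
  intros H Hk. replace k with ((k - n) + n)%nat by lia. rewrite !iter_add, H; auto.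
Qed.

(* Over the [k]-th basic interval, [T^n] is inverted on the [T^n]-image of
   the piece of [q] reserved for [k]; distinct points of the union then
   shadow distinct points of [q]. *)
Lemma spread_along_preimages T q al be :
  self_map01 T -> continuous01 T -> top_mixing T ->
  cantor_continuous q -> (forall a, I01 (q a)) ->
  (forall n a b, iter n T (q a) = iter n T (q b) -> a = b) ->
  0 < al -> be < 1 ->
  (forall M, exists n, (n >= M)%nat /\ forall a, al <= iter n T (q a) <= be) ->
  exists (M : R -> Prop) (p : R -> nat -> bool), dense01 M /\ mycielski M /\
    (forall x, M x -> exists n, iter n T x = iter n T (q (p x))) /\
    (forall x y, M x -> M y -> p x = p y -> x = y) /\
    (exists C, cantor_set C /\ forall y, C y -> M y /\ exists a, y = q a).
Proof.
  intros Hs Hc Hm Hq Hq01 Hinj Hal Hbe Hret.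
  destruct interval_basis as [I [HI HIb]].
  (* One time at which [I k] covers [[al, be]] and the whole family lies in [[al, be]], so every
     member has a partner in [I k] with the same image. *)
  assert (Htime : forall k, exists n, covers (iter n T) (I k) (al, be) /\
    forall a, al <= iter n T (q a) <= be).
  { intros k. destruct (HI k) as [H1 [H2 H3]].
    destruct (mixing_covers T (fst (I k)) (snd (I k)) al be) as [N HN]; auto; try lra.
    destruct (Hret N) as [n [Hn Ha]]. exists n; split; auto.
    rewrite (surjective_pairing (I k)); auto. }
  destruct (choice_any _ Htime) as [tm Htm].
  assert (Hsel : forall k, exists gh : ((nat -> bool) -> nat -> bool) * ((nat -> bool) -> R),
    (forall s s', fst gh s = fst gh s' -> s = s') /\ cantor_continuous (snd gh) /\
    forall s, fst (I k) <= snd gh s <= snd (I k) /\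
      iter (tm k) T (snd gh s) = iter (tm k) T (q (tag (S k) (fst gh s)))).
  { intros k. destruct (HI k) as [H1 [H2 H3]]. destruct (Htm k) as [Hcov Hbd].
    destruct (closed_graph_selection (fun s y => fst (I k) <= y <= snd (I k) /\
      iter (tm k) T y = iter (tm k) T (q (tag (S k) s)))) as [g [h [Hg [Hh HE]]]].
    - intros s. destruct (Hcov (iter (tm k) T (q (tag (S k) s)))) as [y Hy]; eauto.
    - intros s y [Hy _]; lra.
    - intros s y HnE.
      destruct (Rlt_or_le y (fst (I k))) as [Hy|Hy].
      { exists O, (fst (I k) - y); split; [lra|]. intros s' y' _ Hd [HI' _].
        apply Rabs_def2 in Hd; lra. }
      destruct (Rlt_or_le (snd (I k)) y) as [Hy'|Hy'].
      { exists O, (y - snd (I k)); split; [lra|]. intros s' y' _ Hd [HI' _].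
        apply Rabs_def2 in Hd; lra. }
      set (F := iter (tm k) T) in *. set (Q := q (tag (S k) s)) in *.
      assert (HF : continuous01 F) by (apply iter_continuous; auto).
      assert (Hpos : Rabs (F y - F Q) > 0).
      { apply Rabs_pos_lt; intros E; apply HnE; split; [lra|lra]. }
      destruct (HF y) with (eps := Rabs (F y - F Q) / 2) as [d [Hd Hy1]];
        [unfold I01; lra|lra|].
      destruct (HF Q) with (eps := Rabs (F y - F Q) / 2) as [d' [Hd' HQ1]];
        [apply Hq01|lra|].
      destruct (Hq (tag (S k) s) d' Hd') as [n Hn].
      exists n, d; split; auto. intros s' y' Hs' Hyy' [HI' E].
      specialize (Hy1 y' ltac:(unfold I01; lra) Hyy').
      specialize (HQ1 (q (tag (S k) s')) (Hq01 _)).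
      assert (HQ2 : Rabs (F (q (tag (S k) s')) - F Q) < Rabs (F y - F Q) / 2).
      { apply HQ1, Hn. intros i Hi; apply tag_agree with (n := n); auto. }
      rewrite E in Hy1.
      apply Rabs_def2 in Hy1; apply Rabs_def2 in HQ2.
      revert Hy1 HQ2; unfold Rabs; destruct (Rcase_abs _); lra.
    - exists (g, h); simpl; auto. }
  destruct (choice_any _ Hsel) as [gh Hgh]. clear Hsel.
  (* Piece 0 keeps genuine values of [q] and provides the Cantor set of the last conclusion; piece
     [S k'] lies in [I k'] and gives density. [P] records the parameter whose orbit is eventually
     followed. *)
  pose (F := fun k => match k with O => fun s => q (tag O s) | S k' => snd (gh k') end).
  pose (P := fun k => match k with O => fun s => tag O s
                                | S k' => fun s => tag (S k') (fst (gh k') s) end).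
  assert (HFc : forall k, cantor_continuous (F k)).
  { intros [|k]; simpl; [|apply Hgh]. apply cantor_continuous_comp; auto.
    intros n; exists n; apply tag_agree. }
  assert (HFP : forall k, exists n, forall s, iter n T (F k s) = iter n T (q (P k s))).
  { intros [|k]; simpl; [exists O; auto|]. exists (tm k); intros s; apply Hgh. }
  assert (HP : forall k k' s s', P k s = P k' s' -> k = k' /\ s = s').
  { intros [|k] [|k'] s s' E; simpl in E; apply tag_inj in E; destruct E as [E1 E2];
      try discriminate; auto.
    injection E1 as ->. split; auto. apply (Hgh k'); auto. }
  assert (HFi : forall k s s', F k s = F k s' -> s = s').
  { intros k s s' E. destruct (HFP k) as [n Hn]. apply (HP k k).
    apply (Hinj n). rewrite <- !Hn, E; auto. }
  (* [p y] is a parameter recorded for [y]; outside the union its value is arbitrary. *)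
  destruct (choice_any (fun y b => (exists k s, F k s = y) ->
    exists k s, F k s = y /\ P k s = b)) as [p Hp].
  { intros y. destruct (classic (exists k s, F k s = y)) as [[k [s E]]|H].
    - exists (P k s); intros _; eauto.
    - exists (fun _ => true); intros H'; contradiction. }
  exists (fun y => exists k s, F k s = y), p; split; [|split; [|split; [|split]]].
  - split.
    + intros y [[|k] [s <-]]; simpl; [apply Hq01|].
      destruct (Hgh k) as [_ [_ H]]. destruct (H s) as [H1 _].
      pose proof (HI k); unfold I01; lra.
    + intros y Hy e He. unfold I01 in Hy.
      pose proof (Rmax_l 0 (y - e)); pose proof (Rmax_r 0 (y - e)).
      pose proof (Rmin_l 1 (y + e)); pose proof (Rmin_r 1 (y + e)).
      assert (Rmax 0 (y - e) < Rmin 1 (y + e)).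
      { apply Rmax_lub_lt; apply Rmin_glb_lt; lra. }
      destruct (HIb (Rmax 0 (y - e)) (Rmin 1 (y + e))) as [k [Hk1 Hk2]]; auto.
      exists (F (S k) (fun _ => true)); split; [exists (S k), (fun _ => true); auto|]. simpl.
      destruct (Hgh k) as [_ [_ HE]]. destruct (HE (fun _ => true)) as [HE' _].
      apply Rabs_def1; lra.
  - exists (fun k y => exists s, F k s = y); split.
    + intros k; exact (cantor_set_range (F k) (HFc k) (HFi k)).
    + intros y; tauto.
  - intros y Hy. destruct (Hp y Hy) as [k [s [E1 E2]]].
    destruct (HFP k) as [n Hn]. exists n; rewrite <- E2, <- E1; auto.
  - intros y z Hy Hz E. destruct (Hp y Hy) as [k [s [E1 E2]]].
    destruct (Hp z Hz) as [k' [s' [E3 E4]]].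
    destruct (HP k k' s s') as [<- <-]; congruence.
  - exists (fun y => exists s, F O s = y); split.
    + exact (cantor_set_range (F O) (HFc O) (HFi O)).
    + intros y [s E]; split; eauto.
Qed.

(** Both limits see only the tails of the orbits, and finitely many orbits have a common merging
    time. *)
Lemma li_yorke_transfer T delta n x y :
  (forall i, (i < n)%nat -> exists m, iter m T (x i) = iter m T (y i)) ->
  li_yorke_tuple T delta n y -> li_yorke_tuple T delta n x.
Proof.
  intros Hev [Hprox [eta [Heta Hsep]]].
  destruct (bound_below (fun i m => iter m T (x i) = iter m T (y i)) n) as [m Hm]; auto.
  { intros i L L' HL E; apply iter_eq_later with L; auto. }
  assert (Hk : forall i k, (i < n)%nat -> (k >= m)%nat -> iter k T (x i) = iter k T (y i)).
  { intros i k Hi Hk; apply iter_eq_later with m; auto. }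
  split.
  - intros e He N. destruct (Hprox e He (N + m)%nat) as [k [Hk1 Hk2]].
    exists k; split; [lia|]. intros i j Hi Hj. rewrite !Hk by (auto; lia). auto.
  - exists eta; split; auto. intros N. destruct (Hsep (N + m)%nat) as [k [Hk1 Hk2]].
    exists k; split; [lia|]. intros i j Hi Hj Hij. rewrite !Hk by (auto; lia). auto.
Qed.

Lemma li_yorke_delta_le T delta delta' n x : delta' <= delta ->
  li_yorke_tuple T delta n x -> li_yorke_tuple T delta' n x.
Proof.
  intros Hd [Hprox [eta [Heta Hsep]]]; split; auto. exists eta; split; auto; lra.
Qed.

Definition scrambled_family (T : R -> R) (delta : nat -> R) (q : (nat -> bool) -> R) :=
  forall n, (n >= 2)%nat -> delta n > 0 /\ forall a, distinct n a ->
    li_yorke_tuple T (delta n) n (fun i => q (a i)).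

(** Orbits that merge have distance 0 from then on, so a pair of distinct parameters would fail the
    limsup condition. *)
Lemma scrambled_family_inj T delta q : scrambled_family T delta q ->
  forall n a b, iter n T (q a) = iter n T (q b) -> a = b.
Proof.
  intros Hsc n a b E. apply NNPP; intros Hne.
  destruct (Hsc 2%nat (le_n 2)) as [Hd HLY].
  destruct (HLY (fun i => match i with O => a | _ => b end)) as [_ [eta [Heta Hsep]]].
  { intros [|[|i]] [|[|j]] Hi Hj Hij; try lia; auto. }
  destruct (Hsep n) as [k [Hk H]].
  specialize (H O 1%nat ltac:(lia) ltac:(lia) ltac:(lia)). simpl in H.
  rewrite (iter_eq_later T (q a) (q b) n k) in H by (auto; lia).
  rewrite Rminus_diag, Rabs_R0 in H by auto. lra.
Qed.

Lemma scrambled_family_transfer T delta q (M : R -> Prop) (p : R -> nat -> bool) n x :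
  scrambled_family T delta q ->
  (forall x, M x -> exists m, iter m T x = iter m T (q (p x))) ->
  (forall x y, M x -> M y -> p x = p y -> x = y) ->
  (n >= 2)%nat -> distinct n x -> (forall i, (i < n)%nat -> M (x i)) ->
  li_yorke_tuple T (delta n) n x.
Proof.
  intros Hsc Hp Hpi Hn Hx HM.
  apply li_yorke_transfer with (fun i => q (p (x i))).
  - intros i Hi; apply Hp; auto.
  - apply (Hsc n Hn). intros i j Hi Hj Hij E. apply (Hx i j); auto.
Qed.

(** * The three families *)

Lemma scrambled_family_choose T q :
  (forall n, (n >= 2)%nat -> exists d, d > 0 /\ forall a, distinct n a ->
     li_yorke_tuple T d n (fun i => q (a i))) ->
  exists delta, scrambled_family T delta q.
Proof.
  intros H.
  destruct (choice_any (fun n d => (n >= 2)%nat -> d > 0 /\ forall a, distinct n a ->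
     li_yorke_tuple T d n (fun i => q (a i)))) as [delta Hd].
  - intros n. destruct (le_lt_dec 2 n) as [Hn|Hn].
    + destruct (H n Hn) as [d Hd]; exists d; auto.
    + exists 0; intros; lia.
  - exists delta; exact Hd.
Qed.

Lemma separated_of_lt n (y : nat -> R) eta :
  (forall i j, (i < j)%nat -> (j < n)%nat -> y j - y i > eta) ->
  forall i j, (i < n)%nat -> (j < n)%nat -> i <> j -> Rabs (y i - y j) > eta.
Proof.
  intros H i j Hi Hj Hij. destruct (Nat.lt_total i j) as [Hlt|[E|Hlt]]; [|lia|].
  - specialize (H i j Hlt Hj). rewrite Rabs_minus_sym.
    pose proof (Rle_abs (y j - y i)); lra.
  - specialize (H j i Hlt Hi). pose proof (Rle_abs (y i - y j)); lra.
Qed.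

(* The orbit of a point visits the basic intervals numbered [code m s] at
   prescribed times, which gives density, proximality and separation at once. *)
Lemma transitive_scrambled_family T :
  self_map01 T -> continuous01 T -> top_mixing T ->
  exists (q : (nat -> bool) -> R) (delta : nat -> R), cantor_continuous q /\
    (forall a, I01 (q a)) /\ scrambled_family T delta q /\
    forall u v, 0 <= u -> u < v -> v <= 1 -> forall M,
      exists n, (n >= M)%nat /\ forall a, u < iter n T (q a) < v.
Proof.
  intros Hs Hc Hm.
  destruct interval_basis as [V [HV HVb]].
  (* Codes of a given level take finitely many values, so one waiting time serves all transitions
     between consecutive levels. Hence the visiting times [t m] do not depend on the point. *)
  assert (Hgap : forall m, exists h, (h > 0)%nat /\
    forall a b, covers (iter h T) (V (code m a)) (V (code (S m) b))).
  { intros m. destruct (code_bounded m) as [B HB]. destruct (code_bounded (S m)) as [B' HB'].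
    destruct (bound_below (fun v h => forall v', (v' < S B')%nat -> forall n, (n >= h)%nat ->
      covers (iter n T) (V v) (V v')) (S B)) as [h Hh].
    - intros v L L' HL H v' Hv' n Hn; apply H; auto; lia.
    - intros v _.
      destruct (bound_below (fun v' h => forall n, (n >= h)%nat ->
        covers (iter n T) (V v) (V v')) (S B')) as [h Hh].
      + intros v' L L' HL H n Hn; apply H; lia.
      + intros v' _. destruct (HV v) as [H1 [H2 H3]]. destruct (HV v') as [H4 [H5 H6]].
        rewrite (surjective_pairing (V v)), (surjective_pairing (V v')).
        apply mixing_covers; auto; lra.
      + exists h; auto.
    - exists (S h); split; [lia|]. intros a b.
      specialize (HB a); specialize (HB' b). apply (Hh (code m a)); lia. }
  destruct (choice_any _ Hgap) as [h Hh].
  pose (t := fix t m := match m with O => O | S m' => (h m' + t m')%nat end).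
  assert (Ht : forall m, (m <= t m)%nat).
  { induction m as [|m IH]; simpl; [lia|]. destruct (Hh m) as [H _]; lia. }
  pose (inV := fun m s y => fst (V (code m s)) <= iter (t m) T y <= snd (V (code m s))).
  (* Finitely many visits are realized backwards: prescribe the final position and pull it back
     through the coverings. *)
  assert (Hfin : forall s m y, fst (V (code m s)) <= y <= snd (V (code m s)) ->
    exists x, I01 x /\ iter (t m) T x = y /\ forall j, (j <= m)%nat -> inV j s x).
  { intros s; induction m as [|m IH]; intros y Hy.
    - exists y; split; [|split; auto].
      + pose proof (HV (code O s)); unfold I01; lra.
      + intros j Hj; replace j with O by lia; exact Hy.
    - destruct (Hh m) as [_ Hcov]. destruct (Hcov s s y Hy) as [y' [Hy' E]].
      destruct (IH y' Hy') as [x [Hx [Ex Hin]]].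
      exists x; split; auto.
      assert (Ex' : iter (t (S m)) T x = y) by (simpl; rewrite iter_add, Ex; auto).
      split; auto. intros j Hj. destruct (Nat.eq_dec j (S m)) as [->|Hne].
      + unfold inV; rewrite Ex'; auto.
      + apply Hin; lia. }
  assert (Hout : forall s m x, I01 x -> ~ inV m s x ->
    exists d, d > 0 /\ forall y, I01 y -> Rabs (y - x) < d -> ~ inV m s y).
  { intros s m x Hx Hn.
    assert (He : exists e, e > 0 /\ forall z, Rabs (z - iter (t m) T x) < e ->
      ~ (fst (V (code m s)) <= z <= snd (V (code m s)))).
    { unfold inV in Hn.
      destruct (Rlt_or_le (iter (t m) T x) (fst (V (code m s)))) as [H|H].
      - exists (fst (V (code m s)) - iter (t m) T x); split; [lra|].
        intros z Hz Hz'; apply Rabs_def2 in Hz; lra.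
      - exists (iter (t m) T x - snd (V (code m s))); split; [lra|].
        intros z Hz Hz'; apply Rabs_def2 in Hz; lra. }
    destruct He as [e [He Hz]].
    destruct (iter_continuous T (t m) Hs Hc x Hx e He) as [d [Hd Hcd]].
    exists d; split; auto. intros y Hy Hyx; apply Hz; auto. }
  destruct (closed_graph_selection (fun s y => I01 y /\ forall m, inV m s y))
    as [g [q [Hg [Hq HE]]]].
  - intros s.
    destruct (choice_any (fun m x => I01 x /\ forall j, (j <= m)%nat -> inV j s x))
      as [u Hu].
    { intros m. destruct (Hfin s m (fst (V (code m s)))) as [x [Hx [_ Hin]]].
      - pose proof (HV (code m s)); lra.
      - exists x; auto. }
    (* An accumulation point of the finite-stage solutions makes all the visits, as each single
       visit is a closed condition. *)
    destruct (Bolzano_Weierstrass u (fun c => 0 <= c <= 1) (compact_P3 0 1)) as [l Hl].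
    { intros m; apply Hu. }
    assert (Hacc : forall d, d > 0 -> forall m, exists p, (m <= p)%nat /\ Rabs (u p - l) < d).
    { intros d Hd m. destruct (Hl (fun y => Rabs (y - l) < d) m) as [p Hp]; [|eauto].
      exists (mkposreal d Hd); intros y Hy; exact Hy. }
    assert (Hl01 : I01 l).
    { unfold I01; split; apply Rnot_lt_le; intros Hlt.
      - destruct (Hacc (- l)) with (m := O) as [p [_ Hp]]; [lra|].
        destruct (Hu p) as [[H1 H2] _]. apply Rabs_def2 in Hp; lra.
      - destruct (Hacc (l - 1)) with (m := O) as [p [_ Hp]]; [lra|].
        destruct (Hu p) as [[H1 H2] _]. apply Rabs_def2 in Hp; lra. }
    exists l; split; auto. intros m. apply NNPP; intros Hn.
    destruct (Hout s m l Hl01 Hn) as [d [Hd Hy]].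
    destruct (Hacc d Hd m) as [p [Hmp Hp]].
    destruct (Hu p) as [Hp01 Hin]. exact (Hy (u p) Hp01 Hp (Hin m Hmp)).
  - intros s x [Hx _]; exact Hx.
  - intros s x Hn.
    destruct (Rlt_or_le x 0) as [H0|H0].
    { exists O, (- x); split; [lra|]. intros s' x' _ Hd [H _].
      unfold I01 in H; apply Rabs_def2 in Hd; lra. }
    destruct (Rlt_or_le 1 x) as [H1|H1].
    { exists O, (x - 1); split; [lra|]. intros s' x' _ Hd [H _].
      unfold I01 in H; apply Rabs_def2 in Hd; lra. }
    assert (Hx : I01 x) by (split; auto).
    assert (Hm' : exists m, ~ inV m s x).
    { apply not_all_ex_not; intros H; apply Hn; auto. }
    destruct Hm' as [m Hm']. destruct (Hout s m x Hx Hm') as [d [Hd Hy]].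
    destruct (code_locally_constant m) as [L HL].
    exists L, d; split; auto. intros s' x' Hs' Hd' [Hx' Hin].
    apply (Hy x' Hx' Hd'). unfold inV; rewrite (HL s s' Hs'); apply Hin.
  - assert (Hvisit : forall v M, exists k, (k >= M)%nat /\ forall a,
      fst (V v) <= iter k T (q a) <= snd (V v)).
    { intros v M. destruct (code_constant v M) as [m [Hmm Hv]].
      exists (t m); split; [specialize (Ht m); lia|]. intros a.
      destruct (HE a) as [_ H]. specialize (H m). unfold inV in H. rewrite Hv in H; auto. }
    destruct (scrambled_family_choose T q) as [delta Hdelta].
    { intros n Hn.
      assert (Hp : 0 < INR n) by (apply lt_0_INR; lia).
      pose proof (Rinv_0_lt_compat _ Hp) as Hip.
      (* The [i]-th point will be sent into the first half of the [i]-th of [n] equal cells.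
         Distances then exceed [1 / (2 n)], which serves as [eta]; half of it is the constant. *)
      exists (/ INR n / 4); split; [lra|]. intros a Ha; split.
      - intros e He N.
        pose proof (Rmin_l 1 e); pose proof (Rmin_r 1 e).
        assert (0 < Rmin 1 e) by (apply Rmin_glb_lt; lra).
        (* All members visit one basic interval of length below [e], since some later code is
           constantly its index. *)
        destruct (HVb 0 (Rmin 1 e)) as [v [Hv1 Hv2]]; auto; [lra|].
        destruct (Hvisit v N) as [k [Hk Hv]]. exists k; split; auto.
        intros i j _ _. pose proof (Hv (a i)); pose proof (Hv (a j)).
        apply Rabs_def1; lra.
      - exists (/ INR n / 2); split; [lra|]. intros N.
        destruct (choice_any (fun i v => (i < n)%nat ->
          INR i / INR n < fst (V v) /\ snd (V v) < INR i / INR n + / INR n / 2)) as [v Hv].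
        { intros i. destruct (le_lt_dec n i) as [Hi|Hi]; [exists O; intros; lia|].
          destruct (HVb (INR i / INR n) (INR i / INR n + / INR n / 2)) as [w Hw].
          - apply Rmult_le_pos; [apply pos_INR|lra].
          - lra.
          - assert (H1 : INR i + 1 <= INR n) by (rewrite <- S_INR; apply le_INR; lia).
            apply Rmult_le_compat_r with (r := / INR n) in H1; [|lra].
            rewrite Rinv_r in H1 by lra. unfold Rdiv; lra.
          - exists w; auto. }
        destruct (code_assign n (fun i => g (a i)) v N) as [m [Hmm Hcode]].
        { intros i j Hi Hj Hij E. apply (Ha i j Hi Hj Hij), Hg, E. }
        exists (t m); split; [specialize (Ht m); lia|].
        assert (Hin : forall i, (i < n)%nat -> INR i / INR n < iter (t m) T (q (a i)) <
          INR i / INR n + / INR n / 2).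
        { intros i Hi. destruct (HE (a i)) as [_ H]. specialize (H m).
          unfold inV in H. rewrite (Hcode i Hi) in H. specialize (Hv i Hi); lra. }
        apply separated_of_lt with (y := fun i => iter (t m) T (q (a i))).
        intros i j Hij Hj.
        pose proof (Hin i ltac:(lia)); pose proof (Hin j Hj).
        assert (H1 : INR i + 1 <= INR j) by (rewrite <- S_INR; apply le_INR; lia).
        apply Rmult_le_compat_r with (r := / INR n) in H1; [|lra].
        unfold Rdiv in *; lra. }
    exists q, delta; split; [auto|split; [|split; auto]].
    + intros a; apply (HE a).
    + intros u v Hu Huv Hv M. destruct (HVb u v Hu Huv Hv) as [k [Hk1 Hk2]].
      destruct (Hvisit k M) as [n [Hn Ha]]. exists n; split; auto.
      intros a; specialize (Ha a); lra.
Qed.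

Lemma closed_set_I01 A x : (forall x, A x -> I01 x) ->
  (forall e, e > 0 -> exists y, A y /\ Rabs (x - y) < e) -> I01 x.
Proof.
  intros HA H. unfold I01; split; apply Rnot_lt_le; intros Hlt.
  - destruct (H (- x)) as [y [Hy Hd]]; [lra|]. apply HA in Hy; unfold I01 in Hy.
    apply Rabs_def2 in Hd; lra.
  - destruct (H (x - 1)) as [y [Hy Hd]]; [lra|]. apply HA in Hy; unfold I01 in Hy.
    apply Rabs_def2 in Hd; lra.
Qed.

Lemma omega_limit_closed_invariant T x : self_map01 T -> continuous01 T -> I01 x ->
  closed_invariant T (omega_limit T x).
Proof.
  intros Hs Hc Hx.
  assert (H01 : forall y, omega_limit T x y -> I01 y).
  { intros y Hy. apply closed_set_I01 with (fun z => exists k, z = iter k T x).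
    - intros z [k ->]; apply iter_self_map; auto.
    - intros e He. destruct (Hy e He O) as [k [_ Hk]].
      exists (iter k T x); split; [eauto|]. rewrite Rabs_minus_sym; auto. }
  split; [auto|split].
  - intros y Hy e He N. destruct (Hy (e / 2)) as [z [Hz Hyz]]; [lra|].
    destruct (Hz (e / 2) ltac:(lra) N) as [k [Hk Hkz]].
    exists k; split; auto. apply Rabs_def2 in Hyz; apply Rabs_def2 in Hkz.
    apply Rabs_def1; lra.
  - intros y Hy e He N. destruct (Hc y (H01 y Hy) e He) as [d [Hd H]].
    destruct (Hy d Hd N) as [k [Hk Hky]].
    exists (S k); split; [lia|]. simpl. apply H; auto. apply iter_self_map; auto.
Qed.

(** * Orbits coded by the horseshoe *)

Section CodedOrbits.
Context (T : R -> R) (hself : self_map01 T) (hcont : continuous01 T)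
  (hmix : top_mixing T) (N : nat) (x : (nat -> bool) -> R) (HN : (N > 0)%nat)
  (Hx : cantor_continuous x) (Hx01 : forall s, 1 / 4 <= x s <= 3 / 4)
  (Hxs : forall s, iter N T (x s) = x (shift s))
  (Hxd : forall s s', s O <> s' O -> Rabs (x s - x s') >= 1 / 4).

Lemma coded_I01 s : I01 (x s).
Proof. specialize (Hx01 s); unfold I01; lra. Qed.

Lemma coded_iter t s : iter (t * N) T (x s) = x (fun i => s (t + i)%nat).
Proof.
  revert s; induction t as [|t IH]; intros s; [reflexivity|].
  replace (S t * N)%nat with (t * N + N)%nat by lia. rewrite iter_add, Hxs, IH.
  f_equal.
Qed.

Lemma coded_iter_separated t s s' : s t <> s' t ->
  Rabs (iter (t * N) T (x s) - iter (t * N) T (x s')) >= 1 / 4.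
Proof. intros H. rewrite !coded_iter. apply Hxd. rewrite Nat.add_0_r; auto. Qed.

(** A difference at position [r] becomes a distance of at least 1/4 after [r * N] iterates, and
    these boundedly many iterates are uniformly continuous. *)
Lemma coded_separated l : exists d, d > 0 /\ forall s s' r, (r < l)%nat -> s r <> s' r ->
  Rabs (x s - x s') >= d.
Proof.
  destruct (iter_uniform T (l * N) (1 / 4)) as [d [Hd H]]; auto; [lra|].
  exists d; split; auto. intros s s' r Hr Hne. apply Rnot_lt_ge; intros Hlt.
  specialize (H (r * N)%nat ltac:(nia) (x s) (x s') (coded_I01 _) (coded_I01 _) Hlt).
  pose proof (coded_iter_separated r s s' Hne); lra.
Qed.

Lemma coded_inj s s' : x s = x s' -> s = s'.
Proof.
  intros E. apply NNPP; intros Hne. destruct (first_difference s s' Hne) as [r [_ Hr]].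
  pose proof (coded_iter_separated r s s' Hr) as H.
  rewrite E, Rminus_diag, Rabs_R0 in H by auto; lra.
Qed.

Lemma coded_return (y : (nat -> bool) -> nat -> bool) M : exists n, (n >= M)%nat /\
  forall a, 1 / 4 <= iter n T (x (y a)) <= 3 / 4.
Proof.
  exists (M * N)%nat; split; [nia|]. intros a. rewrite coded_iter; apply Hx01.
Qed.

Lemma ruler_continuous : cantor_continuous (fun a => x (ruler a)).
Proof.
  apply cantor_continuous_comp; auto.
  apply locally_constant_agree, ruler_locally_constant.
Qed.

(** The symbols differ with bounded gaps, so from any time [k] a distance of at least 1/4 is reached
    within a bounded number of iterates; uniform continuity carries a lower bound back to time
    [k]. *)
Lemma ruler_orbits_distal a b : a <> b -> exists e, e > 0 /\ forall k,
  Rabs (iter k T (x (ruler a)) - iter k T (x (ruler b))) >= e.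
Proof.
  intros Hab. destruct (ruler_distal a b Hab) as [G HG].
  destruct (iter_uniform T (N + G * N) (1 / 4)) as [d [Hd H]]; auto; [lra|].
  exists d; split; auto. intros k. apply Rnot_lt_ge; intros Hlt.
  (* Symbols are read at multiples of [N] only, so [k] is first rounded up; this costs at most [N]
     iterates. *)
  destruct (HG (k / N + 1)%nat) as [g [Hg Hne]].
  pose proof (Nat.div_mod k N); pose proof (Nat.mod_upper_bound k N).
  set (m := (k / N + 1 + g)%nat) in *.
  assert (Hm : (k <= m * N)%nat) by (unfold m; nia).
  specialize (H (m * N - k)%nat ltac:(unfold m in *; nia) _ _
    (iter_self_map T k hself _ (coded_I01 _)) (iter_self_map T k hself _ (coded_I01 _)) Hlt).
  rewrite <- !iter_add in H. replace (m * N - k + k)%nat with (m * N)%nat in H by lia.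
  pose proof (coded_iter_separated m _ _ Hne); lra.
Qed.

Notation q := (fun a => x (hierarchical a)).

Lemma hierarchical_continuous : cantor_continuous q.
Proof.
  apply cantor_continuous_comp; auto.
  apply locally_constant_agree, hierarchical_locally_constant.
Qed.

(** Proximality comes from a common long block. Separation comes from windows of length [l], and [d]
    is uniform because [l] depends only on [n]. *)
Lemma hierarchical_scrambled : exists delta, scrambled_family T delta q.
Proof.
  apply scrambled_family_choose. intros n Hn.
  destruct (hierarchical_separated n) as [l Hl].
  destruct (coded_separated l) as [d [Hd Hsep]].
  exists (d / 4); split; [lra|]. intros a Ha; split.
  - intros e He M.
    destruct (Hx (hierarchical (dense_seq O)) (e / 2)) as [L HL]; [lra|].
    destruct (hierarchical_proximal (M + L)) as [t [Ht Heq]].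
    exists (t * N)%nat; split; [nia|].
    assert (Hcl : forall i, Rabs (iter (t * N) T (q (a i)) - x (hierarchical (dense_seq O)))
      < e / 2).
    { intros i. rewrite coded_iter. apply HL. intros k Hk; apply Heq; lia. }
    intros i j _ _. pose proof (Hcl i) as H1; pose proof (Hcl j) as H2.
    apply Rabs_def2 in H1; apply Rabs_def2 in H2. apply Rabs_def1; lra.
  - exists (d / 2); split; [lra|]. intros M.
    destruct (Hl a Ha M) as [t [Ht Hne]].
    exists (t * N)%nat; split; [nia|]. intros i j Hi Hj Hij.
    destruct (Hne i j Hi Hj Hij) as [r [Hr Hd']]. rewrite !coded_iter.
    pose proof (Hsep (fun k => hierarchical (a i) (t + k)%nat)
      (fun k => hierarchical (a j) (t + k)%nat) r Hr Hd'). lra.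
Qed.

(** Uniform recurrence of the symbols; the bound [G] serves every parameter [a] and every starting
    time [k]. *)
Lemma hierarchical_orbits_recur b e : e > 0 -> exists G, forall a k,
  exists g, (g <= G)%nat /\ Rabs (iter (k + g) T (q a) - q b) < e.
Proof.
  intros He. destruct (Hx (hierarchical b) e He) as [L HL].
  destruct (hierarchical_uniformly_recurrent b L) as [G HG].
  exists (N + G * N)%nat; intros a k.
  destruct (HG a (k / N + 1)%nat) as [g [Hg Heq]].
  pose proof (Nat.div_mod k N); pose proof (Nat.mod_upper_bound k N).
  set (m := (k / N + 1 + g)%nat) in *.
  assert (Hm : (k <= m * N)%nat) by (unfold m; nia).
  exists (m * N - k)%nat; split; [unfold m; nia|].
  replace (k + (m * N - k))%nat with (m * N)%nat by lia. rewrite coded_iter.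
  apply HL. intros i Hi; apply Heq; auto.
Qed.

(** The choice of the constant parameter is immaterial: by [hierarchical_minimal_omega] every
    parameter gives the same limit set. *)
Definition hierarchical_minimal : R -> Prop := omega_limit T (q (fun _ => false)).

Local Notation A := hierarchical_minimal.

Lemma hierarchical_minimal_closed_invariant : closed_invariant T A.
Proof. apply omega_limit_closed_invariant; auto. apply coded_I01. Qed.

(** The point [z] is close to some iterate of the base orbit, which comes near [q b] within [G]
    steps. As [G] is fixed beforehand, uniform continuity lets [z] follow for that long. *)
Lemma hierarchical_minimal_approaches z b e : A z -> e > 0 ->
  exists g, Rabs (iter g T z - q b) < e.
Proof.
  intros Hz He. destruct (hierarchical_orbits_recur b (e / 2)) as [G HG]; [lra|].
  destruct (iter_uniform T G (e / 2)) as [d [Hd H]]; auto; [lra|].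
  destruct (Hz d Hd O) as [k [_ Hk]].
  destruct (HG (fun _ => false) k) as [g [Hg Hkg]].
  exists g. specialize (H g Hg (iter k T (q (fun _ => false))) z).
  rewrite <- iter_add, Nat.add_comm in H.
  assert (H1 : Rabs (iter (k + g) T (q (fun _ => false)) - iter g T z) < e / 2).
  { apply H; auto; [apply iter_self_map, coded_I01; auto|].
    apply hierarchical_minimal_closed_invariant; auto. }
  apply Rabs_def2 in H1; apply Rabs_def2 in Hkg. apply Rabs_def1; lra.
Qed.

Lemma hierarchical_minimal_contains b : A (q b).
Proof.
  intros e He M. destruct (hierarchical_orbits_recur b e He) as [G HG].
  destruct (HG (fun _ => false) M) as [g [_ Hg]]. exists (M + g)%nat; split; [lia|auto].
Qed.

(** The orbit of any point of [B] approaches the base point, so the closed invariant set [B]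
    contains the base orbit and all its limit points. *)
Lemma hierarchical_minimal_set : minimal_set T A.
Proof.
  split; [apply hierarchical_minimal_closed_invariant|split].
  - exists (q (fun _ => false)); apply hierarchical_minimal_contains.
  - intros B [HB01 [HBc HBi]] [b Hb] HBA z Hz.
    assert (Hit : forall y k, B y -> B (iter k T y)).
    { intros y k Hy; induction k; simpl; auto. }
    assert (Hq : B (q (fun _ => false))).
    { apply (HBc (q (fun _ => false))); intros e He.
      destruct (hierarchical_minimal_approaches b (fun _ => false) e (HBA b Hb) He)
        as [g Hg].
      exists (iter g T b); split; auto. rewrite Rabs_minus_sym; auto. }
    apply (HBc z); intros e He. destruct (Hz e He O) as [k [_ Hk]].
    exists (iter k T (q (fun _ => false))); split; auto. rewrite Rabs_minus_sym; auto.
Qed.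

Lemma hierarchical_minimal_iter z k : A z -> A (iter k T z).
Proof.
  intros Hz; induction k; simpl; auto. apply hierarchical_minimal_closed_invariant; auto.
Qed.

(** The limit set depends on the tail only, and that of [q b] is a nonempty closed invariant subset
    of [A], so minimality gives equality. *)
Lemma hierarchical_minimal_omega y b n : iter n T y = iter n T (q b) ->
  forall z, omega_limit T y z <-> A z.
Proof.
  intros E.
  assert (Hiff : forall z, omega_limit T y z <-> omega_limit T (q b) z).
  { intros z; split; intros H e He M; destruct (H e He (M + n)%nat) as [k [Hk Hd]];
      exists k; (split; [lia|]).
    - rewrite <- (iter_eq_later T _ _ n k E) by lia; auto.
    - rewrite (iter_eq_later T _ _ n k E) by lia; auto. }
  assert (Hsub : forall z, omega_limit T (q b) z -> A z).
  { intros z Hz. destruct hierarchical_minimal_closed_invariant as [_ [HAc _]].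
    apply (HAc z); intros e He. destruct (Hz e He O) as [k [_ Hk]].
    exists (iter k T (q b)); split; [|rewrite Rabs_minus_sym; auto].
    apply hierarchical_minimal_iter, hierarchical_minimal_contains. }
  intros z; rewrite Hiff; split; auto.
  destruct hierarchical_minimal_set as [_ [_ Hmin]]. apply Hmin; auto.
  - apply omega_limit_closed_invariant; auto. apply coded_I01.
  - exists (q b); intros e He M.
    destruct (hierarchical_orbits_recur b e He) as [G HG].
    destruct (HG b M) as [g [_ Hg]]. exists (M + g)%nat; split; [lia|auto].
Qed.

(** A periodic [z] would have its whole orbit fixed by [iter P T]. This orbit approaches each [q b],
    so each [q b] would be fixed too, and then each hierarchical sequence would have period [P]. *)
Lemma hierarchical_minimal_aperiodic z P : A z -> (P > 0)%nat -> iter P T z <> z.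
Proof.
  intros Hz HP E.
  assert (Hk : forall k, iter P T (iter k T z) = iter k T z).
  { intros k. rewrite <- iter_add, Nat.add_comm, iter_add, E; auto. }
  assert (Hq : forall b, iter P T (q b) = q b).
  { intros b. apply Rminus_diag_uniq. apply NNPP; intros Hne.
    set (e := Rabs (iter P T (q b) - q b) / 2).
    assert (He : e > 0).
    { pose proof (Rabs_pos_lt _ Hne). unfold e; lra. }
    destruct (iter_continuous T P hself hcont (q b) (coded_I01 _) e He) as [d [Hd H]].
    pose proof (Rmin_l d e); pose proof (Rmin_r d e).
    destruct (hierarchical_minimal_approaches z b (Rmin d e) Hz) as [g Hg].
    { apply Rmin_glb_lt; auto. }
    assert (Hmove : Rabs (iter P T (iter g T z) - iter P T (q b)) < e).
    { apply H; [|lra]. apply hierarchical_minimal_closed_invariant.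
      apply hierarchical_minimal_iter; auto. }
    rewrite Hk in Hmove.
    pose proof (Rabs_triang (iter P T (x (hierarchical b)) - iter g T z)
      (iter g T z - x (hierarchical b))) as Ht.
    replace (iter P T (x (hierarchical b)) - iter g T z + (iter g T z - x (hierarchical b)))
      with (iter P T (x (hierarchical b)) - x (hierarchical b)) in Ht by ring.
    rewrite Rabs_minus_sym in Hmove. unfold e in *; lra. }
  destruct (hierarchical_not_periodic P HP) as [b [t Ht]]. apply Ht.
  (* Being fixed by [iter P T] implies being fixed by its [N]-th power, which acts on the codes as
     the shift by [P]. *)
  assert (Hs : iter (P * N) T (x (hierarchical b)) = x (hierarchical b)).
  { rewrite Nat.mul_comm, iter_mul. generalize N as m.
    induction m as [|m IH]; simpl; auto. rewrite IH; apply Hq. }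
  rewrite coded_iter in Hs. apply coded_inj in Hs.
  apply (f_equal (fun s => s t)) in Hs. rewrite Nat.add_comm; exact Hs.
Qed.

(** Two close returns to [z] at different times cannot both hit [z], by aperiodicity, so no point is
    isolated. An interval inside [A] would, by mixing, have an image containing the point coded by a
    constant sequence, which [iter N T] fixes. *)
Lemma hierarchical_minimal_cantor : cantor_set A.
Proof.
  destruct hierarchical_minimal_closed_invariant as [HA01 [HAc HAi]].
  apply cantor_set_of_perfect; auto.
  - intros z e Hz He.
    destruct (Hz e He O) as [k [_ Hk]].
    destruct (Hz e He (S k)) as [k' [Hk' Hd]].
    assert (HA : forall j, A (iter j T (q (fun _ => false)))).
    { intros j; apply hierarchical_minimal_iter, hierarchical_minimal_contains. }
    destruct (Req_dec (iter k T (q (fun _ => false))) z) as [E|E]; [|eauto].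
    destruct (Req_dec (iter k' T (q (fun _ => false))) z) as [E'|E']; [|eauto].
    exfalso. apply (hierarchical_minimal_aperiodic z (k' - k)); auto; [lia|].
    rewrite <- E at 1. rewrite <- iter_add.
    replace (k' - k + k)%nat with k' by lia. auto.
  - intros u v Huv. apply NNPP; intros Hno.
    assert (Hin : forall w, u <= w <= v -> A w).
    { intros w Hw; apply NNPP; intros HnA; apply Hno; eauto. }
    pose proof (HA01 u (Hin u ltac:(lra))) as Hu.
    pose proof (HA01 v (Hin v ltac:(lra))) as Hv. unfold I01 in Hu, Hv.
    destruct (mixing_covers T u v (1 / 4) (3 / 4)) as [n Hn]; auto; try lra.
    destruct (Hn n (le_n n) (x (fun _ => false))) as [w [Hw E]]; [apply Hx01|].
    apply (hierarchical_minimal_aperiodic (x (fun _ => false)) N).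
    2: exact HN.
    2: exact (Hxs (fun _ => false)).
    rewrite <- E. apply hierarchical_minimal_iter, Hin; auto.
  - exists (q (fun _ => false)); apply hierarchical_minimal_contains.
Qed.

End CodedOrbits.

(** * Assembling the three Mycielski sets *)

Theorem mainTheorem11 (T : R -> R)
  (hself : self_map01 T) (hcont : continuous01 T) (hmix : top_mixing T) :
  exists (M1 M2 M3 : R -> Prop) (delta : nat -> R),
    dense01 M1 /\ mycielski M1 /\
    dense01 M2 /\ mycielski M2 /\
    dense01 M3 /\ mycielski M3 /\
    (forall n : nat, (n >= 2)%nat -> delta n > 0) /\
    (* (1) *)
    (forall n : nat, (n >= 2)%nat -> forall x : nat -> R,
       (forall i j, (i < n)%nat -> (j < n)%nat -> i <> j -> x i <> x j) ->
       ((forall i, (i < n)%nat -> M1 (x i)) -> li_yorke_tuple T (delta n) n x) /\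
       ((forall i, (i < n)%nat -> M2 (x i)) -> li_yorke_tuple T (delta n) n x)) /\
    (* (2) *)
    (forall x, M1 x -> dense_orbit T x) /\
    (* (3) *)
    (exists A : R -> Prop, minimal_set T A /\ cantor_set A /\
       (forall x, M2 x -> forall y, omega_limit T x y <-> A y) /\
       (exists C : R -> Prop, cantor_set C /\ forall y, C y -> M2 y /\ A y)) /\
    (* (4) *)
    (forall x y, M3 x -> M3 y -> ~ li_yorke_pair T x y).
Proof.
  destruct (transitive_scrambled_family T) as [q1 [d1 [Hq1 [Hq1I [Hsc1 Hdense1]]]]]; auto.
  destruct (spread_along_preimages T q1 (1 / 4) (3 / 4))
    as [M1 [p1 [HM1d [HM1m [Hp1 [Hp1i _]]]]]]; auto; try lra.
  { apply scrambled_family_inj with d1; auto. }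
  { intros M. destruct (Hdense1 (1 / 4) (3 / 4)) with (M := M) as [n [Hn Ha]]; try lra.
    exists n; split; auto. intros a; specialize (Ha a); lra. }
  destruct (horseshoe T) as [N [x [HN [Hx [Hx01 [Hxs Hxd]]]]]]; auto.
  assert (Hx1 : forall s, I01 (x s)) by (intros s; specialize (Hx01 s); unfold I01; lra).
  destruct (hierarchical_scrambled T hself hcont N x) as [d2 Hsc2]; auto.
  destruct (spread_along_preimages T (fun a => x (hierarchical a)) (1 / 4) (3 / 4))
    as [M2 [p2 [HM2d [HM2m [Hp2 [Hp2i [C [HC HCM]]]]]]]]; auto; try lra.
  { apply hierarchical_continuous; auto. }
  { apply scrambled_family_inj with d2; auto. }
  { intros M; apply (coded_return T N x) with (y := hierarchical); auto. }
  assert (Hdistal : forall a b, a <> b -> exists e, e > 0 /\ forall k,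
    Rabs (iter k T (x (ruler a)) - iter k T (x (ruler b))) >= e).
  { apply (ruler_orbits_distal T hself hcont N); auto. }
  destruct (spread_along_preimages T (fun a => x (ruler a)) (1 / 4) (3 / 4))
    as [M3 [p3 [HM3d [HM3m [Hp3 [Hp3i _]]]]]]; auto; try lra.
  { apply ruler_continuous; auto. }
  { intros n a b E. apply NNPP; intros Hne. destruct (Hdistal a b Hne) as [e [He H]].
    specialize (H n). rewrite E, Rminus_diag, Rabs_R0 in H by auto; lra. }
  { intros M; apply (coded_return T N x) with (y := ruler); auto. }
  (* One sequence of constants has to serve both [M1] and [M2]. *)
  exists M1, M2, M3, (fun n => Rmin (d1 n) (d2 n)).
  do 6 (split; [auto|]). split; [|split; [|split; [|split]]].
  - intros n Hn. apply Rmin_glb_lt; [apply (Hsc1 n Hn)|apply (Hsc2 n Hn)].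
  - intros n Hn y Hy; split; intros HyM.
    + apply li_yorke_delta_le with (d1 n); [apply Rmin_l|].
      apply scrambled_family_transfer with q1 M1 p1; auto.
    + apply li_yorke_delta_le with (d2 n); [apply Rmin_r|].
      apply scrambled_family_transfer with (fun a => x (hierarchical a)) M2 p2; auto.
  - intros y Hy z Hz e He. destruct (Hp1 y Hy) as [n Hn]. unfold I01 in Hz.
    pose proof (Rmax_l 0 (z - e)); pose proof (Rmax_r 0 (z - e)).
    pose proof (Rmin_l 1 (z + e)); pose proof (Rmin_r 1 (z + e)).
    assert (Rmax 0 (z - e) < Rmin 1 (z + e)).
    { apply Rmax_lub_lt; apply Rmin_glb_lt; lra. }
    (* The visit is taken after time [n], when the orbit of [y] has merged with that of
       [q1 (p1 y)]. *)
    destruct (Hdense1 (Rmax 0 (z - e)) (Rmin 1 (z + e))) with (M := n) as [k [Hk Ha]]; auto.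
    exists k. rewrite (iter_eq_later T _ _ n k Hn) by lia.
    specialize (Ha (p1 y)). apply Rabs_def1; lra.
  - exists (hierarchical_minimal T x).
    split; [apply hierarchical_minimal_set with N; auto|].
    split; [apply hierarchical_minimal_cantor with N; auto|].
    split.
    + intros y Hy. destruct (Hp2 y Hy) as [n Hn].
      apply hierarchical_minimal_omega with N (p2 y) n; auto.
    + exists C; split; auto. intros y Hy. destruct (HCM y Hy) as [HyM [a ->]].
      split; auto. apply hierarchical_minimal_contains with N; auto.
  - intros y z Hy Hz [d [Hd [Hprox [eta [Heta Hsep]]]]].
    destruct (Hp3 y Hy) as [n Hn]. destruct (Hp3 z Hz) as [n' Hn'].
    (* Equal parameters force [y = z], and then the limsup condition fails; different parameters
       give distal tails, and then the liminf condition fails. *)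
    destruct (classic (p3 y = p3 z)) as [E|E].
    + apply Hp3i in E; auto. subst z.
      destruct (Hsep O) as [k [_ Hk]].
      specialize (Hk O 1%nat ltac:(lia) ltac:(lia) ltac:(lia)). simpl in Hk.
      rewrite Rminus_diag, Rabs_R0 in Hk by auto; lra.
    + destruct (Hdistal _ _ E) as [e [He H]].
      destruct (Hprox e He (n + n')%nat) as [k [Hk Hc]].
      specialize (Hc O 1%nat ltac:(lia) ltac:(lia)). simpl in Hc.
      rewrite (iter_eq_later T _ _ n k Hn), (iter_eq_later T _ _ n' k Hn') in Hc by lia.
      specialize (H k); lra.
Qed.
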